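(* Put $$\varphi_3(x)=-\frac{x^2\,(x-1)\,(49x-81)^7}{4\,(16807x^3-9261x^2-13851x+6561)^3}.$$ Then $\varphi_3:\mathbb{P}^1\to\mathbb{P}^1$ is a covering of degree $10$ which defines a pull-back transformation from a hypergeometric equation with local exponent differences $(1/2,1/3,1/7)$ (in some order at the singular points) to a hypergeometric equation with local exponent differences $(1/3,1/7,2/7)$ (in some order). Moreover, in a neighborhood of $x=0$ the following identities hold: $${}_2F_1\!\left(\tfrac{5}{42},\tfrac{19}{42};\tfrac57;x\right)=\left(1-\tfrac{19}{9}x-\tfrac{343}{243}x^2+\tfrac{16807}{6561}x^3\right)^{-1/28}{}_2F_1\!\left(\tfrac1{84},\tfrac{29}{84};\tfrac67;\varphi_3(x)\right),$$ $${}_2F_1\!\left(\tfrac{5}{42},\tfrac{19}{42};\tfrac67;x\right)=\left(1-\tfrac{141}{2}x+\tfrac{5145}{32}x^2-\tfrac{16807}{256}x^3\right)^{-1/28}{}_2F_1\!\left(\tfrac1{84},\tfrac{29}{84};\tfrac67;\varphi_3(1-x)\right),$$ $${}_2F_1\!\left(\tfrac{5}{42},\tfrac{17}{42};\tfrac23;x\right)=(1-x)^{-1/84}\left(1-\tfrac{81}{49}x\right)^{-1/12}{}_2F_1\!\left(\tfrac1{84},\tfrac{13}{84};\tfrac23;\tfrac{1}{\varphi_3(1/x)}\right).$$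
   Context: ${}_2F_1(A,B;C;z)$ is the Gauss hypergeometric function, a solution of the hypergeometric equation $z(1-z)y''+(C-(A+B+1)z)y'-AB\,y=0$, whose local exponent differences at $z=0,1,\infty$ are (up to sign) $1-C$, $C-A-B$, $A-B$. A pull-back transformation is $z\mapsto\varphi(x)$, $y(z)\mapsto Y(x)=\theta(x)y(\varphi(x))$ with $\varphi$ a rational function and $\theta$ a product of powers of rational functions; it is said to be defined by the covering $\varphi$ (with suitable $\theta$), and it transforms the equation for $y$ into the equation for $Y$. The identities are between analytic functions near $x=0$; fractional powers of functions with value $1$ at $x=0$ denote the branch with value $1$ at $x=0$. *)

(* Defs.v *)
From HB Require Import structures.
From mathcomp Require Import all_boot all_order all_algebra.
From mathcomp Require Import all_classical all_reals all_analysis.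
From mathcomp Require Import complex.

Set Implicit Arguments.
Unset Strict Implicit.
Unset Printing Implicit Defensive.

Import Order.TTheory GRing.Theory Num.Theory.
Import numFieldNormedType.Exports.

Local Open Scope classical_set_scope.
Local Open Scope complex_scope.
Local Open Scope ring_scope.

(* R[i] carries no canonical topology in the libraries, whereas every abstract
   numFieldType does.  All topological notions are therefore defined over an
   abstract K and used at K := R[i]. *)

Section OverAField.
Variable K : numFieldType.
Implicit Types (a b c x z : K) (y f : K -> K).

Definition near_point (x0 : K) (P : K -> Prop) : Prop :=
  \forall x \near x0, P x.

Definition holomorphic_near (x0 : K) f : Prop :=
  \forall x \near x0, derivable f x 1.

(* Rising factorial (a)_n. *)
Definition pochhammer a (n : nat) : K := \prod_(k < n) (a + k%:R).

Definition hyp2F1_coef a b c (n : nat) : K :=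
  pochhammer a n * pochhammer b n / (pochhammer c n * n`!%:R).

(* Sum of the Gauss series; only meaningful where the series converges, in
   particular for `|z| < 1 and c not in {0, -1, -2, ...}. *)
Definition hyp2F1 a b c z : K :=
  limn (series (fun n => hyp2F1_coef a b c n * z ^+ n)).

Definition hypergeometric_solution_near a b c (z0 : K) y : Prop :=
  \forall z \near z0,
    [/\ derivable y z 1, derivable (derive1 y) z 1 &
        z * (1 - z) * derive1 (derive1 y) z
          + (c - (a + b + 1) * z) * derive1 y z - a * b * y z = 0].

Definition eq_up_to_sign x z : Prop := x = z \/ x = - z.

(* The local exponent differences at 0, 1 and infinity are defined up to sign
   and are listed here in an arbitrary order. *)
Definition exponent_differences a b c (d : seq K) : Prop :=
  exists e0 e1 einf : K,
    [/\ perm_eq [:: e0; e1; einf] d, eq_up_to_sign (1 - c) e0,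
        eq_up_to_sign (c - a - b) e1 & eq_up_to_sign (a - b) einf].

(* A rational function, as a numerator and a denominator. *)
Definition ratfun : Type := ({poly K} * {poly K})%type.

Definition ratfun_eval (r : ratfun) x : K := r.1.[x] / r.2.[x].

(* The self-map of the projective line K + {infinity}, with infinity = None,
   induced by a fraction in lowest terms. *)
Definition P1map (r : ratfun) (x : option K) : option K :=
  match x with
  | Some x => if r.2.[x] == 0 then None else Some (ratfun_eval r x)
  | None => if (size r.2 < size r.1)%N then None
            else Some (r.1`_(size r.2).-1 / lead_coef r.2)
  end.

(* A (branched) covering of degree d: all fibres outside a finite set S of
   branch points have exactly d points. *)
Definition P1_covering (r : ratfun) (d : nat) : Prop :=
  [/\ coprimep r.1 r.2, (0 < d)%N &
      exists S : seq (option K), forall w : option K, w \notin S ->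
        exists s : seq (option K),
          [/\ uniq s, size s = d & forall x : option K, (x \in s) = (P1map r x == w)]].

Definition phi3 : ratfun :=
  (- ('X^2 * ('X - 1%:P) * (49 *: 'X - 81%:P) ^+ 7),
   4 *: (16807 *: 'X^3 - 9261 *: 'X^2 - 13851 *: 'X + 6561%:P) ^+ 3).

End OverAField.

Arguments phi3 {K}.

Section OverTheComplexNumbers.
Variable R : realType.

Definition cexp (z : R[i]) : R[i] :=
  let: a +i* b := z in (expR a * cos b) +i* (expR a * sin b).

(* Principal argument in ]-pi, pi]: off the negative real axis it is given by
   tan (arg / 2) = b / (|z| + a). *)
Definition carg (z : R[i]) : R :=
  let: a +i* b := z in
  if (b == 0) && (a < 0) then pi
  else 2 * atan (b / (Num.sqrt (a ^+ 2 + b ^+ 2) + a)).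

Definition clog (z : R[i]) : R[i] :=
  let: a +i* b := z in ln (Num.sqrt (a ^+ 2 + b ^+ 2)) +i* carg z.

(* Principal power.  When f is continuous with f 0 = 1, x |-> cpow (f x) w is,
   near 0, the branch of f ^ w with value 1 at 0. *)
Definition cpow (z w : R[i]) : R[i] := cexp (w * clog z).

(* theta is, near x0, a branch of the multivalued function
   \prod_i (r i) ^ (alpha i). *)
Definition power_product_branch (n : nat) (r : 'I_n -> ratfun R[i])
    (alpha : 'I_n -> R[i]) (x0 : R[i]) (theta : R[i] -> R[i]) : Prop :=
  exists L : 'I_n -> R[i] -> R[i],
    [/\ forall i, holomorphic_near x0 (L i),
        forall i, near_point x0 (fun x => cexp (L i x) = ratfun_eval (r i) x) &
        near_point x0 (fun x => theta x = cexp (\sum_i alpha i * L i x))].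

(* The substitution Y(x) = theta(x) y(phi(x)), for some product theta of powers
   of rational functions, carries the hypergeometric equation with parameters
   (a, b, c) to the one with parameters (a', b', c').  This is expressed on
   germs of solutions at the points x0 where theta is regular and nonzero and
   phi(x0) is not one of the singular points 0, 1, infinity; all but finitely
   many x0 are such when phi is not constant. *)
Definition defines_pullback (phi : ratfun R[i]) (a b c a' b' c' : R[i]) : Prop :=
  exists (n : nat) (r : 'I_n -> ratfun R[i]) (alpha : 'I_n -> R[i]),
    (forall i, (r i).1 != 0 /\ (r i).2 != 0) /\
    forall (x0 : R[i]) (theta y : R[i] -> R[i]),
      phi.2.[x0] != 0 ->
      ratfun_eval phi x0 != 0 -> ratfun_eval phi x0 != 1 ->
      (forall i, (r i).1.[x0] != 0 /\ (r i).2.[x0] != 0) ->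
      power_product_branch r alpha x0 theta ->
      hypergeometric_solution_near a b c (ratfun_eval phi x0) y ->
      hypergeometric_solution_near a' b' c' x0
        (fun x => theta x * y (ratfun_eval phi x)).

End OverTheComplexNumbers.

(* Main.v *)
Require Import Defs.
From HB Require Import structures.
From mathcomp Require Import all_boot all_order all_algebra.
From mathcomp Require Import all_classical all_reals all_analysis.
From mathcomp Require Import complex separable ring lra.

(* The map phi3 is ramified only above 0, 1 and infinity: 1 - phi3 is a square
   over the denominator of phi3, and phi3' = - x (49 x - 81)^6 crit3 / (4 pole3^4),
   where crit3 is that square root and pole3 the cubic in the denominator.  With
   theta = pole3^(-1/28), substituting theta(x) y(phi3(x)) in the target equation
   gives the source equation multiplied by theta x (49 x - 81)^5 / pole3^2, which
   amounts to three identities between rational functions.  The factor is regular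
   at x = 0, so both sides of each identity are twice differentiable solutions,
   equal to 1 at 0, of one hypergeometric equation near its singular point 0.
   Such a solution is unique when c > 0: along a ray from 0, if D is the
   difference then t (d/dt) |D'|^2 <= (O(t) - 2 c) max |D'|^2 at a maximum of |D'|,
   which forces D' = 0.  The second identity is the first one transported by
   x |-> 1 - x, and the third uses the same computation for 1 / phi3(1 / x). *)

Set Implicit Arguments.
Unset Strict Implicit.
Unset Printing Implicit Defensive.

Import Order.TTheory GRing.Theory Num.Theory.
Import numFieldNormedType.Exports.
Import ComplexField.Normc.

Local Open Scope classical_set_scope.
Local Open Scope complex_scope.
Local Open Scope ring_scope.

Local Notation Re := (@complex.Re _).
Local Notation Im := (@complex.Im _).

(** * Pull-back of hypergeometric equations *)

(** The exponent -1/28 and the target parameters come from local exponents. A point where [phi3] has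
    multiplicity m multiplies the exponent difference of the source equation by m. Over 0
    (difference 1/7) lie 0, 1 and 81/49 with multiplicities 2, 1, 7; over infinity (1/3) lie the
    roots of [pole3] with multiplicity 3 and infinity with multiplicity 1; over 1 (1/2) lie the
    double points, the roots of [crit3]. Multiplicities 7, 3 and 2 thus give difference 1, which can
    be made an ordinary point, and only 0, 1, infinity remain, with differences 2/7, 1/7, 1/3. At a
    root of [pole3] the source exponent 1/84 at infinity becomes 3/84 = 1/28, which theta cancels.
    For 1 / phi3(1 / x) the source has 0 and infinity exchanged, and the poles at 1 and 49/81, of
    orders 1 and 7, give the exponents -1/84 and -7/84 = -1/12. The pull-back is an identity between
    coefficients, so one lemma serves ordinary points and the singular point 0 alike. *)

Section Calculus.
Variable K : numFieldType.
Implicit Types (f g y : K -> K) (x l m : K).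

Lemma scalemulE (a b : K) : a *: b = a * b.
Proof. by []. Qed.

(** Without a quotient and with a large inequality, the estimate also holds at [h = 0]. In this form
    derivatives can be compared between R and R[i], coordinate by coordinate or along a ray. *)
Lemma is_derive_normP f x l :
  is_derive x 1 f l <->
  forall e : K, 0 < e -> \forall h \near 0, `|f (x + h) - f x - h * l| <= e * `|h|.
Proof.
pose q (h : K) := h^-1 *: (f (h *: (1 : K) + x) - f x).
have qE e h : h != 0 ->
    (`|l - q h| <= e) = (`|f (x + h) - f x - h * l| <= e * `|h|).
  move=> h0; rewrite -(ler_pM2r (x := `|h|)) ?normr_gt0// -normrM distrC mulrBl.
  by rewrite /q !scalemulE mulr1 [h + x]addrC mulrAC mulVf// mul1r [l * h]mulrC.
have cvgE : (q @ 0^' --> l) <->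
    forall e : K, 0 < e -> \forall h \near 0, `|f (x + h) - f x - h * l| <= e * `|h|.
  rewrite cvgrPdist_le; split=> H e e0; have := H e e0.
    rewrite near_withinE; apply: filterS => h Hh.
    have [->|h0] := eqVneq h 0; last by rewrite -qE//; apply: Hh.
    by rewrite addr0 mul0r subr0 subrr normr0 mulr0.
  rewrite near_withinE; apply: filterS => h Hh h0.
  by rewrite qE.
split=> [[df dl]|/cvgE H].
  by apply/cvgE; rewrite -dl; exact: df.
apply: DeriveDef.
  by apply/cvg_ex; exists l.
by apply/cvg_lim.
Qed.

Lemma is_derive_continuous f x l : is_derive x 1 f l -> {for x, continuous f}.
Proof.
move=> [df _]; apply: differentiable_continuous.
exact/derivable1_diffP.
Qed.

Lemma is_derive1_comp_field f g x l m :
  is_derive x 1 f l -> is_derive (f x) 1 g m ->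
  is_derive x 1 (g \o f) (m * l).
Proof.
move=> [df <-] [dg <-].
have := df => /derivable1_diffP df'; have := dg => /derivable1_diffP dg'.
have dgf : differentiable (g \o f) x by exact: differentiable_comp.
apply: DeriveDef; first exact/derivable1_diffP.
have -> : 'D_1 (g \o f) x = 'd (g \o f) x 1 by rewrite deriveE.
rewrite (diff_comp df' dg').
transitivity ('d f x 1 *: g^`()%classic (f x)).
  exact: (congr1 (@^~ ('d f x 1)) (diff1E dg')).
rewrite (diff1E df').
rewrite !derive1E.
by rewrite !scalemulE mul1r mulrC.
Qed.

Lemma fun_is_deriveD f g x l m : is_derive x 1 f l -> is_derive x 1 g m ->
  is_derive x 1 (fun z => f z + g z) (l + m).
Proof. exact: is_deriveD. Qed.

Lemma fun_is_deriveM f g x l m : is_derive x 1 f l -> is_derive x 1 g m ->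
  is_derive x 1 (fun z => f z * g z) (l * g x + f x * m).
Proof.
move=> df dg; apply: is_derive_eq (is_deriveM df dg) _.
by rewrite !scalemulE addrC [g x * l]mulrC.
Qed.

Lemma fun_is_deriveV f x l : is_derive x 1 f l -> f x != 0 ->
  is_derive x 1 (fun z => (f z)^-1) (- l / f x ^+ 2).
Proof.
move=> [df dl] fx0; apply: DeriveDef; first exact: derivableV.
by rewrite deriveV // dl scalemulE mulrC mulrN mulNr.
Qed.

Lemma fun_is_deriveX f n x l : is_derive x 1 f l ->
  is_derive x 1 (fun z => f z ^+ n) (n%:R * f x ^+ n.-1 * l).
Proof.
move=> df; elim: n => [|n IHn].
  by rewrite !mul0r; exact: (is_derive_cst _ x (1 : K)).
have -> : (fun z => f z ^+ n.+1) = (fun z => f z * f z ^+ n).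
  by apply/funext => z; rewrite exprS.
apply: is_derive_eq (fun_is_deriveM df IHn) _.
case: n {IHn} => [|n] /=; first by rewrite expr0 !mulr1; ring.
by rewrite !exprS -[n.+2%:R]natr1; ring.
Qed.

Lemma is_derive_horner (p : {poly K}) x : is_derive x 1 (horner p) p^`().[x].
Proof.
elim/poly_ind: p => [|p c IHp].
  have -> : horner (0 : {poly K}) = cst 0 by apply/funext => z; rewrite horner0.
  by rewrite derivC horner0; exact: (is_derive_cst _ x (1 : K)).
have -> : horner (p * 'X + c%:P) = (fun z => p.[z] * z + c).
  by apply/funext => z; rewrite hornerMXaddC.
apply: is_derive_eq (fun_is_deriveD (fun_is_deriveM IHp (is_derive_id x 1))
  (is_derive_cst c x 1)) _.
by rewrite derivMXaddC hornerD hornerM hornerX addr0 mulr1 addrC.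
Qed.

Lemma is_derive_near_neq0 f x l : is_derive x 1 f l -> f x != 0 ->
  \forall z \near x, f z != 0.
Proof.
move=> df fx.
have /cvgrPdist_lt /(_ `|f x|) := is_derive_continuous df.
rewrite normr_gt0 => /(_ fx); apply: filterS => z; apply: contraTneq => ->.
by rewrite subr0 ltxx.
Qed.

(* From right to left: functions that agree near x0 have derivatives that agree
   near x0, so [derive1 y] may be replaced by y1 before it is derived again. *)
Lemma solution_nearP (a b c x0 : K) y :
  hypergeometric_solution_near a b c x0 y <->
  exists y1 y2 : K -> K, \forall z \near x0,
    [/\ is_derive (z : K) 1 y (y1 z), is_derive z 1 y1 (y2 z) &
        z * (1 - z) * y2 z + (c - (a + b + 1) * z) * y1 z - a * b * y z = 0].
Proof.
split=> [H|[y1 [y2 H]]].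
  exists (derive1 y), (derive1 (derive1 y)); move: H; apply: filterS => z [H1 H2 H3].
  split; last exact: H3.
  - by rewrite derive1E; apply: derivableP; exact: H1.
  - by rewrite derive1E; apply: derivableP; exact: H2.
have := near_join H; apply: filterS2 H => z [H1 H2 H3] Hz.
have y1E : \forall w \near z, y1 w = derive1 y w.
  by move: Hz; apply: filterS => w [[? <-] _ _]; rewrite derive1E.
have [D1 E1] := near_eq_is_derive y1E H2; have [D0 E0] := H1.
split; [exact: D0|exact: D1|].
by rewrite !derive1E E1 E0.
Qed.

(** [t] is the logarithmic derivative of [theta], so [theta] factors out of the substituted equation
    and only rational functions are left in the applications. The three identities compare the
    coefficients of y'', y' and y at [phi x]; [k] is the factor relating the two equations. *)
Lemma pullback_solution (a b c a' b' c' x0 : K)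
    (theta y phi t t1 p p1 k : K -> K) :
  (\forall x \near x0, is_derive (x : K) 1 theta (theta x * t x)) ->
  (\forall x \near x0, is_derive (x : K) 1 t (t1 x)) ->
  (\forall x \near x0, is_derive (x : K) 1 phi (p x)) ->
  (\forall x \near x0, is_derive (x : K) 1 p (p1 x)) ->
  (\forall x \near x0, let c1 := c' - (a' + b' + 1) * x in
    [/\ x * (1 - x) * p x ^+ 2 = k x * (phi x * (1 - phi x)),
        x * (1 - x) * (2 * t x * p x + p1 x) + c1 * p x =
          k x * (c - (a + b + 1) * phi x) &
        x * (1 - x) * (t x ^+ 2 + t1 x) + c1 * t x - a' * b' = - (k x * (a * b))]) ->
  hypergeometric_solution_near a b c (phi x0) y ->
  hypergeometric_solution_near a' b' c' x0 (fun x => theta x * y (phi x)).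
Proof.
move=> Hth Ht Hphi Hp Hid /solution_nearP [y1 [y2 Hy]]; apply/solution_nearP.
exists (fun x => theta x * (t x * y (phi x) + p x * y1 (phi x))).
exists (fun x => theta x * (t x * (t x * y (phi x) + p x * y1 (phi x)) +
  (t1 x * y (phi x) + t x * (p x * y1 (phi x)) +
   (p1 x * y1 (phi x) + p x * (p x * y2 (phi x)))))).
have phic : {for x0, continuous phi}.
  exact: is_derive_continuous (nbhs_singleton Hphi).
have {}Hy := phic _ Hy.
near=> x.
have dth : is_derive x 1 theta (theta x * t x) by near: x.
have dt : is_derive x 1 t (t1 x) by near: x.
have dphi : is_derive x 1 phi (p x) by near: x.
have dp : is_derive x 1 p (p1 x) by near: x.
have [dy dy1 ode] : [/\ is_derive (phi x) 1 y (y1 (phi x)),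
    is_derive (phi x) 1 y1 (y2 (phi x)) &
    phi x * (1 - phi x) * y2 (phi x) + (c - (a + b + 1) * phi x) * y1 (phi x)
     - a * b * y (phi x) = 0] by near: x; exact: Hy.
have dyp := is_derive1_comp_field dphi dy.
have dy1p := is_derive1_comp_field dphi dy1.
split.
- apply: is_derive_eq (fun_is_deriveM dth dyp) _.
  by rewrite /=; ring.
- apply: is_derive_eq (fun_is_deriveM dth
    (fun_is_deriveD (fun_is_deriveM dt dyp) (fun_is_deriveM dp dy1p))) _.
  by rewrite /=; ring.
have [e2 e1 e0] : let c1 := c' - (a' + b' + 1) * x in
    [/\ x * (1 - x) * p x ^+ 2 = k x * (phi x * (1 - phi x)),
        x * (1 - x) * (2 * t x * p x + p1 x) + c1 * p x =
          k x * (c - (a + b + 1) * phi x) &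
        x * (1 - x) * (t x ^+ 2 + t1 x) + c1 * t x - a' * b' = - (k x * (a * b))].
  by near: x.
transitivity (theta x * (x * (1 - x) * p x ^+ 2 * y2 (phi x) +
  (x * (1 - x) * (2 * t x * p x + p1 x) + (c' - (a' + b' + 1) * x) * p x) * y1 (phi x) +
  (x * (1 - x) * (t x ^+ 2 + t1 x) + (c' - (a' + b' + 1) * x) * t x - a' * b') * y (phi x))).
  by ring.
rewrite e2 e1 e0.
transitivity (theta x * k x * (phi x * (1 - phi x) * y2 (phi x) +
  (c - (a + b + 1) * phi x) * y1 (phi x) - a * b * y (phi x))); first by ring.
by rewrite ode mulr0.
Unshelve. all: by end_near. Qed.

(* z |-> 1 - z exchanges the local exponents at 0 and 1. *)
Lemma solution_reflect (a b c z0 : K) y :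
  hypergeometric_solution_near a b c (1 - z0) y ->
  hypergeometric_solution_near a b (a + b + 1 - c) z0 (fun z => y (1 - z)).
Proof.
move=> Hy.
have d1 (x : K) : is_derive x 1 (fun z : K => 1 - z) (- 1).
  apply: is_derive_eq (fun_is_deriveD (is_derive_cst (1 : K) x 1) (is_deriveNid x 1)) _.
  by rewrite add0r.
have := @pullback_solution a b c a b (a + b + 1 - c) z0 (cst 1) y
  (fun z => 1 - z) (cst 0) (cst 0) (cst (- 1)) (cst 0) (cst 1).
have -> : (fun x => cst 1 x * y (1 - x)) = (fun z => y (1 - z)).
  by apply/funext => x; rewrite /cst mul1r.
apply=> //; try by near=> x; rewrite /cst /= ?mulr0; apply: is_derive_cst.
- by near=> x; apply: d1.
- by near=> x; rewrite /cst /=; split; ring.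
Unshelve. all: by end_near. Qed.

End Calculus.

(** * The covering phi3 *)

Section Phi3.
Variable K : numFieldType.
Implicit Types (x : K) (theta y : K -> K).

(** The coefficients are kept as products of powers, so that the numerals stay small. Primes denote
    formal derivatives, and [zero3] carries the sevenfold zero 81/49 of [phi3]. *)
Definition pole3 x : K :=
  7 ^+ 5 * x ^+ 3 - 3 ^+ 3 * 7 ^+ 3 * x ^+ 2 - 19 * 3 ^+ 6 * x + 3 ^+ 8.
Definition pole3' x : K := 3 * 7 ^+ 5 * x ^+ 2 - 2 * 3 ^+ 3 * 7 ^+ 3 * x - 19 * 3 ^+ 6.
Definition pole3'' x : K := 6 * 7 ^+ 5 * x - 2 * 3 ^+ 3 * 7 ^+ 3.
Definition zero3 x : K := 49 * x - 81.
Definition crit3 x : K :=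
  7 ^+ 7 * x ^+ 5 + 2 * 3 ^+ 3 * 7 ^+ 6 * x ^+ 4 - 26 * 3 ^+ 5 * 7 ^+ 4 * x ^+ 3
  + 32 * 3 ^+ 8 * 7 ^+ 2 * x ^+ 2 - 19 * 3 ^+ 11 * x + 2 * 3 ^+ 12.
Definition crit3' x : K :=
  5 * 7 ^+ 7 * x ^+ 4 + 8 * 3 ^+ 3 * 7 ^+ 6 * x ^+ 3 - 78 * 3 ^+ 5 * 7 ^+ 4 * x ^+ 2
  + 64 * 3 ^+ 8 * 7 ^+ 2 * x - 19 * 3 ^+ 11.

Let hornerP := (hornerM, horner_exp, hornerD, hornerN, hornerZ, hornerXn, hornerX, hornerC).

Let numeralsE : [/\ (16807 : K) = 7 ^+ 5, (9261 : K) = 3 ^+ 3 * 7 ^+ 3,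
  (13851 : K) = 19 * 3 ^+ 6 & (6561 : K) = 3 ^+ 8].
Proof. by split; rewrite -!natrX -?natrM; congr (_%:R). Qed.

Lemma phi3_factoredE : phi3 =
  (- ('X^2 * ('X - 1%:P) * (49 *: 'X - 81%:P) ^+ 7),
   4 *: (7 ^+ 5 *: 'X^3 - (3 ^+ 3 * 7 ^+ 3) *: 'X^2 - (19 * 3 ^+ 6) *: 'X
         + (3 ^+ 8)%:P) ^+ 3) :> ratfun K.
Proof. by have [<- <- <- <-] := numeralsE; exact: erefl. Qed.

Lemma phi3_denE x : (phi3 (K := K)).2.[x] = 4 * pole3 x ^+ 3.
Proof. by rewrite phi3_factoredE [X in X.[_]]/= !hornerP. Qed.

Lemma phi3_numE x : (phi3 (K := K)).1.[x] = - (x ^+ 2 * (x - 1) * zero3 x ^+ 7).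
Proof. by rewrite phi3_factoredE [X in X.[_]]/= !hornerP. Qed.

Lemma phi3E x : ratfun_eval phi3 x =
  - (x ^+ 2 * (x - 1) * zero3 x ^+ 7) / (4 * pole3 x ^+ 3).
Proof. by rewrite /ratfun_eval phi3_numE phi3_denE. Qed.

Lemma crit3_sqr x :
  crit3 x ^+ 2 = 4 * pole3 x ^+ 3 + x ^+ 2 * (x - 1) * zero3 x ^+ 7.
Proof. by rewrite /crit3 /pole3 /zero3; ring. Qed.

(** The right-hand side is [x * (x - 1) * zero3 x * pole3 x] times the logarithmic derivative 2/x +
    1/(x - 1) + 7 * 49 / zero3 - 3 pole3'/pole3 of [phi3]. Hence the square root found in
    [crit3_sqr] is also the nontrivial factor of the derivative. *)
Lemma crit3E x : crit3 x =
  2 * (x - 1) * zero3 x * pole3 x + x * zero3 x * pole3 x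
  + 7 ^+ 3 * x * (x - 1) * pole3 x - 3 * pole3' x * x * (x - 1) * zero3 x.
Proof. by rewrite /crit3 /pole3 /pole3' /zero3; ring. Qed.

Definition phi3' x : K := - (x * zero3 x ^+ 6 * crit3 x) / (4 * pole3 x ^+ 4).
Definition phi3'' x : K :=
  - ((zero3 x + 6 * 49 * x) * zero3 x ^+ 5 * crit3 x + x * zero3 x ^+ 6 * crit3' x)
    / (4 * pole3 x ^+ 4)
  + x * zero3 x ^+ 6 * crit3 x * pole3' x / pole3 x ^+ 5.

(* Logarithmic derivative of pole3 ^ (- 1 / 28). *)
Definition dlog3 x : K := - pole3' x / (28 * pole3 x).
Definition dlog3' x : K :=
  (pole3' x ^+ 2 - pole3'' x * pole3 x) / (28 * pole3 x ^+ 2).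

Lemma phi3_identities x : pole3 x != 0 ->
  let c1 := 5 / 7 - (5 / 42 + 19 / 42 + 1) * x in
  let k := x * zero3 x ^+ 5 / pole3 x ^+ 2 in
  let phi := ratfun_eval phi3 x in
  [/\ x * (1 - x) * phi3' x ^+ 2 = k * (phi * (1 - phi)),
      x * (1 - x) * (2 * dlog3 x * phi3' x + phi3'' x) + c1 * phi3' x =
        k * (6 / 7 - (1 / 84 + 29 / 84 + 1) * phi) &
      x * (1 - x) * (dlog3 x ^+ 2 + dlog3' x) + c1 * dlog3 x
        - 5 / 42 * (19 / 42) = - (k * (1 / 84 * (29 / 84)))].
Proof.
move=> g0 /=; rewrite phi3E; split.
- transitivity (x * zero3 x ^+ 5 / pole3 x ^+ 2 *
    (- (x ^+ 2 * (x - 1) * zero3 x ^+ 7) / (4 * pole3 x ^+ 3) *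
    (crit3 x ^+ 2 / (4 * pole3 x ^+ 3)))); last by rewrite crit3_sqr; field.
  by rewrite /phi3'; field.
(* [F] is the difference of the two sides divided by x zero3^5 / (4 pole3^5). The coefficient 57/14
   is 4 + 1/14: 4 from differentiating the denominator pole3^4, 1/14 from [2 * dlog3]. The
   polynomials are expanded only to prove [F = 0]; clearing denominators treats them as atoms. *)
- pose F := (1 - x) * (57 / 14 * x * zero3 x * crit3 x * pole3' x
      - ((zero3 x + 6 * 49 * x) * crit3 x + x * zero3 x * crit3' x) * pole3 x)
    - (5 / 7 - (5 / 42 + 19 / 42 + 1) * x) * zero3 x * crit3 x * pole3 x
    - (24 / 7 * pole3 x ^+ 3 + 19 / 14 * x ^+ 2 * (x - 1) * zero3 x ^+ 7).
  have F0 : F = 0.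
    by rewrite /F /pole3 /pole3' /zero3 /crit3 /crit3'; field.
  apply/eqP; rewrite -subr_eq0; apply/eqP.
  transitivity (F * (x * zero3 x ^+ 5 / (4 * pole3 x ^+ 5))); last by rewrite F0 mul0r.
  by rewrite /F /phi3' /phi3'' /dlog3; field.
- have E : x * (1 - x) * (29 * pole3' x ^+ 2 - 28 * pole3'' x * pole3 x)
      - 28 * (5 / 7 - (5 / 42 + 19 / 42 + 1) * x) * pole3' x * pole3 x
      - 784 * (5 / 42 * (19 / 42)) * pole3 x ^+ 2
      + 784 * (1 / 84 * (29 / 84)) * (x * zero3 x ^+ 5) = 0.
    by rewrite /pole3 /pole3' /pole3'' /zero3; field.
  apply/eqP; rewrite -subr_eq0; apply/eqP.
  transitivity ((x * (1 - x) * (29 * pole3' x ^+ 2 - 28 * pole3'' x * pole3 x)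
      - 28 * (5 / 7 - (5 / 42 + 19 / 42 + 1) * x) * pole3' x * pole3 x
      - 784 * (5 / 42 * (19 / 42)) * pole3 x ^+ 2
      + 784 * (1 / 84 * (29 / 84)) * (x * zero3 x ^+ 5)) / (784 * pole3 x ^+ 2)).
    by rewrite /dlog3 /dlog3'; field.
  by rewrite E mul0r.
Qed.

Lemma is_derive_pole3 x : is_derive x 1 pole3 (pole3' x).
Proof.
have -> : pole3 = horner (7 ^+ 5 *: 'X^3 - (3 ^+ 3 * 7 ^+ 3) *: 'X^2
    - (19 * 3 ^+ 6) *: 'X + (3 ^+ 8)%:P).
  by apply/funext => z; rewrite !hornerP.
apply: is_derive_eq (is_derive_horner _ x) _.
by rewrite !poly.derivE !hornerP /pole3' /=; ring.
Qed.

Lemma is_derive_pole3' x : is_derive x 1 pole3' (pole3'' x).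
Proof.
have -> : pole3' = horner ((3 * 7 ^+ 5) *: 'X^2 - (2 * 3 ^+ 3 * 7 ^+ 3) *: 'X
    - (19 * 3 ^+ 6)%:P).
  by apply/funext => z; rewrite !hornerP.
apply: is_derive_eq (is_derive_horner _ x) _.
by rewrite !poly.derivE !hornerP /pole3'' /=; ring.
Qed.

Lemma is_derive_zero3 x : is_derive x 1 zero3 49.
Proof.
have -> : zero3 = horner (49 *: 'X - 81%:P).
  by apply/funext => z; rewrite !hornerP.
apply: is_derive_eq (is_derive_horner _ x) _.
by rewrite !poly.derivE !hornerP; ring.
Qed.

Lemma is_derive_crit3 x : is_derive x 1 crit3 (crit3' x).
Proof.
have -> : crit3 = horner (7 ^+ 7 *: 'X^5 + (2 * 3 ^+ 3 * 7 ^+ 6) *: 'X^4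
    - (26 * 3 ^+ 5 * 7 ^+ 4) *: 'X^3 + (32 * 3 ^+ 8 * 7 ^+ 2) *: 'X^2
    - (19 * 3 ^+ 11) *: 'X + (2 * 3 ^+ 12)%:P).
  by apply/funext => z; rewrite !hornerP.
apply: is_derive_eq (is_derive_horner _ x) _.
by rewrite !poly.derivE !hornerP /crit3' /=; ring.
Qed.

Lemma is_derive_phi3 x : pole3 x != 0 ->
  is_derive x 1 (ratfun_eval phi3) (phi3' x).
Proof.
move=> g0.
have -> : ratfun_eval phi3 =
    (fun z => (-4^-1) * (z ^+ 2 * (z - 1) * zero3 z ^+ 7) * (pole3 z ^+ 3)^-1).
  by apply/funext => z; rewrite phi3E invfM; ring.
have g3 : pole3 x ^+ 3 != 0 by rewrite expf_neq0.
have D1 := fun_is_deriveM (fun_is_deriveX 2 (is_derive_id x 1))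
     (fun_is_deriveD (is_derive_id x 1) (is_derive_cst (- 1 : K) x 1)).
have D2 := fun_is_deriveM (is_derive_cst (-4^-1 : K) x 1)
  (fun_is_deriveM D1 (fun_is_deriveX 7 (is_derive_zero3 x))).
have D3 := fun_is_deriveM D2 (fun_is_deriveV (fun_is_deriveX 3 (is_derive_pole3 x)) g3).
apply: is_derive_eq D3 _.
by rewrite /phi3' crit3E /cst /=; field.
Qed.

Lemma is_derive_phi3' x : pole3 x != 0 -> is_derive x 1 phi3' (phi3'' x).
Proof.
move=> g0.
have -> : phi3' = (fun z => (-4^-1) * (z * zero3 z ^+ 6 * crit3 z) * (pole3 z ^+ 4)^-1).
  by apply/funext => z; rewrite /phi3' invfM; ring.
have g4 : pole3 x ^+ 4 != 0 by rewrite expf_neq0.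
have D1 := fun_is_deriveM (is_derive_id x 1) (fun_is_deriveX 6 (is_derive_zero3 x)).
have D2 := fun_is_deriveM (is_derive_cst (-4^-1 : K) x 1)
  (fun_is_deriveM D1 (is_derive_crit3 x)).
have D3 := fun_is_deriveM D2 (fun_is_deriveV (fun_is_deriveX 4 (is_derive_pole3 x)) g4).
apply: is_derive_eq D3 _.
by rewrite /phi3'' /cst /=; field.
Qed.

Lemma is_derive_dlog3 x : pole3 x != 0 -> is_derive x 1 dlog3 (dlog3' x).
Proof.
move=> g0.
have -> : dlog3 = (fun z => (-28^-1) * (pole3' z * (pole3 z)^-1)).
  by apply/funext => z; rewrite /dlog3 invfM; ring.
have D := fun_is_deriveM (is_derive_cst (-28^-1 : K) x 1)
  (fun_is_deriveM (is_derive_pole3' x) (fun_is_deriveV (is_derive_pole3 x) g0)).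
apply: is_derive_eq D _.
by rewrite /dlog3' /cst /=; field.
Qed.

Lemma phi3_pullback x0 theta y : pole3 x0 != 0 ->
  (\forall x \near x0, is_derive (x : K) 1 theta (theta x * dlog3 x)) ->
  hypergeometric_solution_near (1 / 84) (29 / 84) (6 / 7) (ratfun_eval phi3 x0) y ->
  hypergeometric_solution_near (5 / 42) (19 / 42) (5 / 7) x0
    (fun x => theta x * y (ratfun_eval phi3 x)).
Proof.
move=> g0 dth; have gN := is_derive_near_neq0 (is_derive_pole3 x0) g0.
apply: (pullback_solution dth (t1 := dlog3') (p := phi3') (p1 := phi3'')
  (k := fun x => x * zero3 x ^+ 5 / pole3 x ^+ 2)).
- by move: gN; apply: filterS => x; exact: is_derive_dlog3.
- by move: gN; apply: filterS => x; exact: is_derive_phi3.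
- by move: gN; apply: filterS => x; exact: is_derive_phi3'.
- by move: gN; apply: filterS => x; exact: phi3_identities.
Qed.

End Phi3.

(** * The inverted covering 1 / phi3(1 / x) *)

Section Psi3.
Variable K : numFieldType.
Implicit Types (x : K) (theta y : K -> K).

(** [zeroV], [poleV] and [critV] are [pole3], [zero3] and [crit3] with their coefficients in reverse
    order. Inversion of the value exchanges zeros and poles, whence the new names. *)
Definition zeroV x : K :=
  7 ^+ 5 - 3 ^+ 3 * 7 ^+ 3 * x - 19 * 3 ^+ 6 * x ^+ 2 + 3 ^+ 8 * x ^+ 3.
Definition zeroV' x : K := - (3 ^+ 3 * 7 ^+ 3) - 38 * 3 ^+ 6 * x + 3 ^+ 9 * x ^+ 2.
Definition poleV x : K := 49 - 81 * x.
Definition critV x : K :=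
  7 ^+ 7 + 2 * 3 ^+ 3 * 7 ^+ 6 * x - 26 * 3 ^+ 5 * 7 ^+ 4 * x ^+ 2
  + 32 * 3 ^+ 8 * 7 ^+ 2 * x ^+ 3 - 19 * 3 ^+ 11 * x ^+ 4 + 2 * 3 ^+ 12 * x ^+ 5.
Definition critV' x : K :=
  2 * 3 ^+ 3 * 7 ^+ 6 - 52 * 3 ^+ 5 * 7 ^+ 4 * x
  + 32 * 3 ^+ 9 * 7 ^+ 2 * x ^+ 2 - 76 * 3 ^+ 11 * x ^+ 3 + 10 * 3 ^+ 12 * x ^+ 4.

Definition phi3V x : K := - (4 * x * zeroV x ^+ 3) / ((1 - x) * poleV x ^+ 7).

Lemma phi3V_E x : x != 0 -> 1 - x != 0 -> poleV x != 0 -> zeroV x != 0 ->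
  (ratfun_eval phi3 x^-1)^-1 = phi3V x.
Proof.
move=> x0 x1 v0 g0; rewrite phi3E /phi3V.
have -> : zero3 x^-1 = poleV x / x by rewrite /zero3 /poleV; field.
have -> : pole3 x^-1 = zeroV x / x ^+ 3 by rewrite /pole3 /zeroV; field.
by have -> : x^-1 - 1 = (1 - x) / x; field; rewrite ?x0 ?x1 ?v0 ?g0.
Qed.

Lemma phi3V_E0 : (ratfun_eval phi3 (0 : K)^-1)^-1 = phi3V 0.
Proof. by rewrite invr0 phi3E /phi3V expr0n /= !(mulr0, mul0r, oppr0) invr0. Qed.

Lemma critV_sqr x :
  critV x ^+ 2 = (1 - x) * poleV x ^+ 7 + 4 * x * zeroV x ^+ 3.
Proof. by rewrite /critV /zeroV /poleV; ring. Qed.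

(** As for [crit3E], this is the logarithmic derivative of [phi3V] multiplied by
    [x * (1 - x) * poleV x * zeroV x]; 567 is 7 * 81. *)
Lemma critV_E x : critV x =
  (1 - x) * poleV x * zeroV x + 3 * x * zeroV' x * (1 - x) * poleV x
  + x * poleV x * zeroV x + 567 * x * (1 - x) * zeroV x.
Proof. by rewrite /critV /zeroV /zeroV' /poleV; ring. Qed.

Definition phi3V' x : K :=
  - (4 * zeroV x ^+ 2 * critV x) / ((1 - x) ^+ 2 * poleV x ^+ 8).
Definition phi3V'' x : K :=
  - 4 * ((2 * zeroV x * zeroV' x * critV x + zeroV x ^+ 2 * critV' x)
           / ((1 - x) ^+ 2 * poleV x ^+ 8)
         + zeroV x ^+ 2 * critV x * (2 / ((1 - x) ^+ 3 * poleV x ^+ 8)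
                                     + 648 / ((1 - x) ^+ 2 * poleV x ^+ 9))).

(* Logarithmic derivative of (1 - x) ^ (- 1 / 84) * poleV ^ (- 1 / 12). *)
Definition dlogV x : K := 1 / 84 / (1 - x) + 27 / 4 / poleV x.
Definition dlogV' x : K :=
  1 / 84 / (1 - x) ^+ 2 + 27 / 4 * 81 / poleV x ^+ 2.

Lemma phi3V_identities x : 1 - x != 0 -> poleV x != 0 ->
  let c1 := 2 / 3 - (5 / 42 + 17 / 42 + 1) * x in
  let k := - (4 * zeroV x) / ((1 - x) * poleV x ^+ 2) in
  let phi := phi3V x in
  [/\ x * (1 - x) * phi3V' x ^+ 2 = k * (phi * (1 - phi)),
      x * (1 - x) * (2 * dlogV x * phi3V' x + phi3V'' x) + c1 * phi3V' x =
        k * (2 / 3 - (1 / 84 + 13 / 84 + 1) * phi) &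
      x * (1 - x) * (dlogV x ^+ 2 + dlogV' x) + c1 * dlogV x
        - 5 / 42 * (17 / 42) = - (k * (1 / 84 * (13 / 84)))].
Proof.
move=> x1 v0 /=.
(* With [1 - x] as an atom, the denominators stay products of powers of two atoms known to be
   nonzero. *)
set y := 1 - x in x1 *.
have e1 : x = 1 - y by rewrite /y; ring.
split.
- transitivity (- (4 * zeroV x) / (y * poleV x ^+ 2) * (phi3V x *
    (critV x ^+ 2 / (y * poleV x ^+ 7)))).
    by rewrite /phi3V /phi3V' -/y; field; rewrite x1 v0.
  by rewrite critV_sqr /phi3V -/y; field; rewrite x1 v0.
(* The difference of the two sides divided by -4 zeroV / (y^2 poleV^9). *)
- pose F := zeroV x * critV x * x * (poleV x / 42 + 27 / 2 * y)
    + x * y * (2 * zeroV' x * critV x + zeroV x * critV' x) * poleV x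
    + x * zeroV x * critV x * (2 * poleV x + 648 * y)
    + (2 / 3 - (5 / 42 + 17 / 42 + 1) * x) * zeroV x * critV x * poleV x
    - 2 / 3 * y * poleV x ^+ 7 - 14 / 3 * x * zeroV x ^+ 3.
  have F0 : F = 0.
    by rewrite /F /y /zeroV /zeroV' /poleV /critV /critV'; field.
  apply/eqP; rewrite -subr_eq0; apply/eqP.
  transitivity (F * (- 4 * zeroV x / (y ^+ 2 * poleV x ^+ 9)));
    last by rewrite F0 mul0r.
  by rewrite /F /phi3V /phi3V' /phi3V'' /dlogV -/y; field; rewrite x1 v0.
(* [T] is [y * poleV x * dlogV x], the numerator of the logarithmic derivative. *)
- pose T := poleV x / 84 + 27 / 4 * y.
  pose F := x * (T ^+ 2 + (poleV x ^+ 2 / 84 + 27 / 4 * 81 * y ^+ 2))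
    + (2 / 3 - (5 / 42 + 17 / 42 + 1) * x) * T * poleV x
    - 5 / 42 * (17 / 42) * y * poleV x ^+ 2 - 4 * (1 / 84 * (13 / 84)) * zeroV x.
  have F0 : F = 0 by rewrite /F /T /y /zeroV /poleV; field.
  apply/eqP; rewrite -subr_eq0; apply/eqP.
  transitivity (F / (y * poleV x ^+ 2)); last by rewrite F0 mul0r.
  by rewrite /F /T /dlogV /dlogV' -/y; field; rewrite x1 v0.
Qed.

Let hornerP := (hornerM, horner_exp, hornerD, hornerN, hornerZ, hornerXn, hornerX, hornerC).

Lemma is_derive_zeroV x : is_derive x 1 zeroV (zeroV' x).
Proof.
have -> : zeroV = horner ((7 ^+ 5)%:P - (3 ^+ 3 * 7 ^+ 3) *: 'X
    - (19 * 3 ^+ 6) *: 'X^2 + 3 ^+ 8 *: 'X^3).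
  by apply/funext => z; rewrite !hornerP.
apply: is_derive_eq (is_derive_horner _ x) _.
by rewrite !poly.derivE !hornerP /zeroV' /=; ring.
Qed.

Lemma is_derive_critV x : is_derive x 1 critV (critV' x).
Proof.
have -> : critV = horner ((7 ^+ 7)%:P + (2 * 3 ^+ 3 * 7 ^+ 6) *: 'X
    - (26 * 3 ^+ 5 * 7 ^+ 4) *: 'X^2 + (32 * 3 ^+ 8 * 7 ^+ 2) *: 'X^3
    - (19 * 3 ^+ 11) *: 'X^4 + (2 * 3 ^+ 12) *: 'X^5).
  by apply/funext => z; rewrite !hornerP.
apply: is_derive_eq (is_derive_horner _ x) _.
by rewrite !poly.derivE !hornerP /critV' /=; ring.
Qed.

Lemma is_derive_poleV x : is_derive x 1 poleV (- 81).
Proof.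
have -> : poleV = horner (49%:P - 81 *: 'X).
  by apply/funext => z; rewrite !hornerP.
apply: is_derive_eq (is_derive_horner _ x) _.
by rewrite !poly.derivE !hornerP; ring.
Qed.

Lemma is_derive_onem x : is_derive x 1 (fun z : K => 1 - z) (- 1).
Proof.
apply: is_derive_eq (fun_is_deriveD (is_derive_cst (1 : K) x 1) (is_deriveNid x 1)) _.
by rewrite add0r.
Qed.

Lemma is_derive_phi3V x : 1 - x != 0 -> poleV x != 0 ->
  is_derive x 1 phi3V (phi3V' x).
Proof.
move=> x1 v0.
have -> : phi3V = (fun z => (- 4) * (z * zeroV z ^+ 3) * ((1 - z) * poleV z ^+ 7)^-1).
  by apply/funext => z; rewrite /phi3V -mulrA; ring.
have d0 : (1 - x) * poleV x ^+ 7 != 0 by rewrite mulf_neq0 // expf_neq0.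
have D1 := fun_is_deriveM (is_derive_cst (- 4 : K) x 1)
  (fun_is_deriveM (is_derive_id x 1) (fun_is_deriveX 3 (is_derive_zeroV x))).
have D2 := fun_is_deriveM (is_derive_onem x) (fun_is_deriveX 7 (is_derive_poleV x)).
apply: is_derive_eq (fun_is_deriveM D1 (fun_is_deriveV D2 d0)) _.
by rewrite /phi3V' critV_E /cst /=; field; rewrite x1 v0.
Qed.

Lemma is_derive_phi3V' x : 1 - x != 0 -> poleV x != 0 ->
  is_derive x 1 phi3V' (phi3V'' x).
Proof.
move=> x1 v0.
have -> : phi3V' = (fun z => (- 4) * (zeroV z ^+ 2 * critV z)
                               * ((1 - z) ^+ 2 * poleV z ^+ 8)^-1).
  by apply/funext => z; rewrite /phi3V' -mulrA; ring.
have d0 : (1 - x) ^+ 2 * poleV x ^+ 8 != 0 by rewrite mulf_neq0 // expf_neq0.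
have D1 := fun_is_deriveM (is_derive_cst (- 4 : K) x 1)
  (fun_is_deriveM (fun_is_deriveX 2 (is_derive_zeroV x)) (is_derive_critV x)).
have D2 := fun_is_deriveM (fun_is_deriveX 2 (is_derive_onem x))
  (fun_is_deriveX 8 (is_derive_poleV x)).
apply: is_derive_eq (fun_is_deriveM D1 (fun_is_deriveV D2 d0)) _.
by rewrite /phi3V'' /cst /=; field; rewrite x1 v0.
Qed.

Lemma is_derive_dlogV x : 1 - x != 0 -> poleV x != 0 ->
  is_derive x 1 dlogV (dlogV' x).
Proof.
move=> x1 v0.
have D1 := fun_is_deriveM (is_derive_cst (1 / 84 : K) x 1)
  (fun_is_deriveV (is_derive_onem x) x1).
have D2 := fun_is_deriveM (is_derive_cst (27 / 4 : K) x 1)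
  (fun_is_deriveV (is_derive_poleV x) v0).
apply: is_derive_eq (fun_is_deriveD D1 D2) _.
by rewrite /dlogV' /cst /=; field; rewrite x1 v0.
Qed.

Lemma phi3V_pullback x0 theta y : 1 - x0 != 0 -> poleV x0 != 0 ->
  (\forall x \near x0, is_derive (x : K) 1 theta (theta x * dlogV x)) ->
  hypergeometric_solution_near (1 / 84) (13 / 84) (2 / 3) (phi3V x0) y ->
  hypergeometric_solution_near (5 / 42) (17 / 42) (2 / 3) x0
    (fun x => theta x * y (phi3V x)).
Proof.
move=> x1 v0 dth.
have yN := is_derive_near_neq0 (is_derive_onem x0) x1.
have vN := is_derive_near_neq0 (is_derive_poleV x0) v0.
apply: (pullback_solution dth (t1 := dlogV') (p := phi3V') (p1 := phi3V'')
  (k := fun x => - (4 * zeroV x) / ((1 - x) * poleV x ^+ 2))).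
- by apply: filterS2 yN vN => x; exact: is_derive_dlogV.
- by apply: filterS2 yN vN => x; exact: is_derive_phi3V.
- by apply: filterS2 yN vN => x; exact: is_derive_phi3V'.
- by apply: filterS2 yN vN => x; exact: phi3V_identities.
Qed.

End Psi3.

(** * Complex power series *)

Section ComplexTopology.
Variable R : realType.
Local Notation K := (R[i] : numFieldType).
Implicit Types (z w : K).

(** The norm of R[i] has values in the partially ordered R[i]. Estimates are carried out with
    [normc], whose values lie in R. *)
Lemma normc_norm z : `|z| = (normc z)%:C.
Proof. by []. Qed.

Lemma normc_ge0 z : 0 <= normc z.
Proof. by case: z => a b; exact: sqrtr_ge0. Qed.

Lemma normc_real (r : R) : normc r%:C = `|r|.
Proof. by rewrite /normc /= expr0n addr0 sqrtr_sqr. Qed.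

Lemma Re_le_normc z : `|Re z| <= normc z.
Proof.
case: z => a b /=; rewrite -sqrtr_sqr ler_sqrt ?lerDl ?sqr_ge0//.
by rewrite addr_ge0 ?sqr_ge0.
Qed.

Lemma Im_le_normc z : `|Im z| <= normc z.
Proof.
case: z => a b /=; rewrite -sqrtr_sqr ler_sqrt ?lerDr ?sqr_ge0//.
by rewrite addr_ge0 ?sqr_ge0.
Qed.

Lemma normc_le_ReIm z : normc z <= `|Re z| + `|Im z|.
Proof.
case: z => a b; have -> : Complex a b = a%:C + (Complex 0 b) by simpc.
apply: le_trans (le_normcD _ _) _; rewrite normc_real /=.
by rewrite expr0n add0r sqrtr_sqr !addr0 add0r.
Qed.

Lemma complex_gt0P (e : K) : 0 < e -> exists2 r : R, 0 < r & e = r%:C.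
Proof.
by case: e => r i; rewrite ltcE /= => /andP[/eqP -> r0]; exists r.
Qed.

Lemma near_normcP (z0 : K) (P : K -> Prop) :
  (\forall z \near z0, P z) <->
  exists2 d : R, 0 < d & forall z, normc (z - z0) < d -> P z.
Proof.
split.
  move=> /nbhs_normP [[e e'] /=]; rewrite ltcE /= => /andP[/eqP -> e0] H.
  exists e => // z zd; apply: H => /=; rewrite distrC normc_norm.
  by rewrite ltcR.
move=> [d d0 H]; apply/nbhs_normP; exists d%:C => /=; first by rewrite ltcR.
by move=> z /=; rewrite distrC normc_norm ltcR; exact: H.
Qed.

Lemma cvg_complexP (s : nat -> K) (l : K) :
  s @ \oo --> l <-> forall e : R, 0 < e -> \forall n \near \oo, normc (l - s n) <= e.
Proof.
rewrite cvgrPdist_le; split=> [H e e0|H [e e'] /=].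
  have : 0 < e%:C :> K by rewrite ltcR.
  by move=> /H; apply: filterS => n; rewrite normc_norm lecR.
rewrite ltcE /= => /andP[/eqP -> /H]; apply: filterS => n.
by rewrite normc_norm lecR.
Qed.

Lemma cvg_complex_ReIm (T : Type) (F : set_system T) (FF : Filter F) (f : T -> K) (l : K) :
  (fun x => Re (f x)) @ F --> Re l -> (fun x => Im (f x)) @ F --> Im l -> f @ F --> l.
Proof.
move=> /cvgrPdist_le HR /cvgrPdist_le HI; apply/cvgrPdist_le => _ /complex_gt0P[e e0 ->].
have e20 : 0 < e / 2 by rewrite divr_gt0.
apply: filterS2 (HR _ e20) (HI _ e20) => n /= h1 h2.
rewrite normc_norm lecR.
apply: le_trans (normc_le_ReIm _) _; rewrite [e]splitr.
by apply: lerD; [move: h1|move: h2]; rewrite raddfB.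
Qed.

Lemma Re_sum (u : nat -> K) n : Re (series u n) = series (Re \o u) n.
Proof. by rewrite !seriesEnat /= raddf_sum. Qed.

Lemma Im_sum (u : nat -> K) n : Im (series u n) = series (Im \o u) n.
Proof. by rewrite !seriesEnat /= raddf_sum. Qed.

Lemma normc_series (u : nat -> K) (v : nat -> R) n :
  (forall n, normc (u n) <= v n) -> normc (series u n) <= series v n.
Proof.
move=> uv; rewrite !seriesEnat /=; elim/big_ind2: _ => //.
  by rewrite normc0.
by move=> x1 x2 y1 y2 h1 h2; apply: le_trans (le_normcD _ _) (lerD h1 h2).
Qed.

(** Convergence is the real comparison test applied to both coordinates. The bound on the limit
    holds up to any e > 0, through a partial sum close to the limit. *)
Lemma dominated_series (u : nat -> K) (v : nat -> R) :
  (forall n, normc (u n) <= v n) -> cvgn (series v) ->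
  cvgn (series u) /\ normc (limn (series u)) <= limn (series v).
Proof.
move=> uv cv.
have v0 n : 0 <= v n := le_trans (normc_ge0 (u n)) (uv n).
have cR : cvgn (series (Re \o u)).
  apply: normed_cvg; apply: (series_le_cvg _ v0 _ cv) => n /=.
    exact: normr_ge0.
  exact: le_trans (Re_le_normc _) (uv n).
have cI : cvgn (series (Im \o u)).
  apply: normed_cvg; apply: (series_le_cvg _ v0 _ cv) => n /=.
    exact: normr_ge0.
  exact: le_trans (Im_le_normc _) (uv n).
have su : series u @ \oo --> (Complex (limn (series (Re \o u))) (limn (series (Im \o u))) : K).
  apply: cvg_complex_ReIm => /=.
    have -> : (fun n => Re (series u n)) = series (Re \o u) by apply/funext => n; exact: Re_sum.
    exact: cR.
  have -> : (fun n => Im (series u n)) = series (Im \o u) by apply/funext => n; exact: Im_sum.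
  exact: cI.
have cu : cvgn (series u) by apply/cvg_ex; eexists; exact: su.
split => //; apply/ler_addgt0Pr => e e0.
have /cvg_complexP /(_ e e0) [N _ /(_ N (leqnn N)) HN] := cu.
rewrite -(subrK (series u N) (limn (series u))).
apply: le_trans (le_normcD _ _) _; rewrite addrC lerD //.
apply: le_trans (normc_series _ uv) _.
apply: (nondecreasing_cvgn_le _ cv) => n m nm.
by apply: nondecreasing_series.
Qed.

End ComplexTopology.

(** * Term-by-term differentiation of power series *)

Section PowerSeries.
Variable R : realType.
Local Notation K := (R[i] : numFieldType).
Implicit Types (z h : K) (u a : nat -> K) (C B r : R).

(** Convergence and value in a single relation: linear combinations of series then need no separate
    convergence conditions. *)
Definition sums u (l : K) := series u @ \oo --> l.

Lemma sums_limn u l : sums u l -> limn (series u) = l.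
Proof. by move=> ul; apply: cvg_lim. Qed.

Lemma sums_unique u l l' : sums u l -> sums u l' -> l = l'.
Proof. by move=> /sums_limn <- /sums_limn. Qed.

Lemma eq_sums u v l : u =1 v -> sums u l -> sums v l.
Proof. by move=> /funext ->. Qed.

Lemma sumsD u v l m : sums u l -> sums v m -> sums (fun n => u n + v n) (l + m).
Proof.
move=> ul vm; rewrite /sums.
have -> : series (fun n => u n + v n) = series u \+ series v.
  by apply/funext => n; rewrite !seriesEnat /= big_split.
exact: cvgD ul vm.
Qed.

Lemma sumsZ u l (k : K) : sums u l -> sums (fun n => k * u n) (k * l).
Proof.
move=> ul; rewrite /sums.
have -> : series (fun n => k * u n) = (fun n => k * series u n).
  by apply/funext => n; rewrite !seriesEnat /= big_distrr.
exact: cvgM (cvg_cst k) ul.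
Qed.

Lemma sumsB u v l m : sums u l -> sums v m -> sums (fun n => u n - v n) (l - m).
Proof.
move=> ul /(sumsZ (k := -1)) vm; rewrite -[m]mul1r -mulNr.
by apply: eq_sums (sumsD ul vm) => n; rewrite mulN1r.
Qed.

Lemma sums_shift u l : sums u l -> sums (fun n => if n is m.+1 then u m else 0) l.
Proof.
move=> ul; rewrite /sums -cvg_shiftS; apply: cvg_trans ul.
apply: near_eq_cvg; near=> n.
by rewrite !seriesEnat /= big_nat_recl //= add0r.
Unshelve. all: by end_near. Qed.

Lemma sums0 u : (forall n, u n = 0) -> sums u 0.
Proof.
move=> u0; rewrite /sums; apply: cvg_near_cst; near=> n.
by rewrite seriesEnat /= big1.
Unshelve. all: by end_near. Qed.

(** A quantitative stand-in for a radius of convergence at least 1/B. Differentiating a series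
    doubles [B], because n + 1 <= 2^n. *)
Definition geom_bounded C B a := forall n, normc (a n) <= C * B ^+ n.

Definition power_series a z : K := limn (series (fun n => a n * z ^+ n)).

Definition deriv_coef a n : K := n.+1%:R * a n.+1.

Lemma normcX z n : normc (z ^+ n) = normc z ^+ n.
Proof.
by elim: n => [|n IHn]; rewrite ?expr0 ?normc1// !exprS normcM IHn.
Qed.

Lemma normc_nat n : normc (n%:R : K) = n%:R :> R.
Proof. by rewrite -(rmorph_nat (real_complex R)) normc_real ger0_norm. Qed.

Lemma nat_le_exp2 n : (n%:R : R) <= 2 ^+ n.
Proof. by rewrite -natrX ler_nat ltnW // ltn_expl. Qed.

Lemma limn_geometric_half C : limn (series (geometric C (2^-1 : R))) = 2 * C.
Proof.
have h1 : `|2^-1 : R| < 1 by rewrite ger0_norm ?invr_ge0// invf_lt1 ?ltr1n.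
have /cvg_lim -> // := cvg_geometric_series (a := C) h1.
by field.
Qed.

Lemma dominated_half u C : (forall n, normc (u n) <= C * 2^-1 ^+ n) ->
  sums u (limn (series u)) /\ normc (limn (series u)) <= 2 * C.
Proof.
move=> uC; have h1 : `|2^-1 : R| < 1.
  by rewrite ger0_norm ?invr_ge0// invf_lt1 ?ltr1n.
have [cu lu] := dominated_series uC (is_cvg_geometric_series (a := C) h1).
by split; [exact: cu | rewrite -limn_geometric_half].
Qed.

Lemma power_series_sums C B a z : 0 < B -> geom_bounded C B a ->
  normc z <= (2 * B)^-1 -> sums (fun n => a n * z ^+ n) (power_series a z).
Proof.
move=> B0 aB zB; apply: (proj1 (dominated_half (C := C) _)) => n.
rewrite normcM normcX.
have C0 : 0 <= C by have := le_trans (normc_ge0 _) (aB 0); rewrite expr0 mulr1.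
apply: le_trans (ler_pM (normc_ge0 _) _ (aB n) (lerXn2r n _ _ zB)) _.
- by rewrite exprn_ge0 ?normc_ge0.
- exact: normc_ge0.
- by rewrite nnegrE invr_ge0 mulr_ge0 // ltW.
- by rewrite -mulrA -exprMn; have -> : B * (2 * B)^-1 = 2^-1 by field; rewrite gt_eqF.
Qed.

Lemma geom_bounded_deriv C B a : 0 < B -> geom_bounded C B a ->
  geom_bounded (C * B) (2 * B) (deriv_coef a).
Proof.
move=> B0 aB n; rewrite /deriv_coef normcM normc_nat.
have C0 : 0 <= C by have := le_trans (normc_ge0 _) (aB 0); rewrite expr0 mulr1.
apply: (le_trans (ler_pM (ler0n _ _) (normc_ge0 _) (lexx _) (aB n.+1))).
rewrite exprMn exprS.
have -> : n.+1%:R * (C * (B * B ^+ n)) = n.+1%:R * (C * B * B ^+ n) by ring.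
have -> : C * B * (2 ^+ n * B ^+ n) = 2 ^+ n * (C * B * B ^+ n) by ring.
apply: ler_wpM2r; last by rewrite -natrX ler_nat ltn_expl.
by rewrite !mulr_ge0 ?exprn_ge0 // ltW.
Qed.

(** The remainders satisfy R(n+1) = (z + h) R(n) + n h^2 z^(n-1). Each summand is at most half of
    the bound at n + 1: the factor 2^n absorbs the factor n. *)
Lemma normc_taylor2 z h r n : 0 < r -> normc z <= r -> normc (z + h) <= r ->
  normc ((z + h) ^+ n - z ^+ n - n%:R * h * z ^+ n.-1)
    <= normc h ^+ 2 / r ^+ 2 * (2 * r) ^+ n.
Proof.
move=> r0 zr zhr; elim: n => [|n IHn].
  rewrite !expr0 subrr mul0r mul0r subrr normc0 mulr1.
  by rewrite divr_ge0 ?exprn_ge0 ?normc_ge0 // ltW.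
have -> : (z + h) ^+ n.+1 - z ^+ n.+1 - n.+1%:R * h * z ^+ n.+1.-1 =
    (z + h) * ((z + h) ^+ n - z ^+ n - n%:R * h * z ^+ n.-1)
    + n%:R * h ^+ 2 * z ^+ n.-1.
  by case: n {IHn} => [|n] /=; rewrite ?expr0 ?expr1 -?[n.+2%:R]natr1 ?exprS; ring.
apply: le_trans (le_normcD _ _) _; rewrite !normcM normc_nat !normcX.
have zn : n%:R * normc h ^+ 2 * normc z ^+ n.-1 <=
    normc h ^+ 2 / r ^+ 2 * (r * (2 * r) ^+ n).
  have -> : normc h ^+ 2 / r ^+ 2 * (r * (2 * r) ^+ n) =
      2 ^+ n * normc h ^+ 2 * (r ^+ n / r).
    by rewrite exprMn; field; rewrite gt_eqF.
  case: n {IHn} => [|n] /=.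
    by rewrite !mul0r !mulr_ge0 ?invr_ge0 ?exprn_ge0 ?normc_ge0 // ltW.
  have -> : r ^+ n.+1 / r = r ^+ n by rewrite exprS mulrAC divff ?mul1r ?gt_eqF.
  apply: ler_pM.
  - by rewrite mulr_ge0 // exprn_ge0 // normc_ge0.
  - by rewrite exprn_ge0 // normc_ge0.
  - by apply: ler_wpM2r; [rewrite exprn_ge0 // normc_ge0 | exact: nat_le_exp2].
  - by apply: lerXn2r; rewrite ?nnegrE ?normc_ge0 // ltW.
apply: le_trans (lerD (ler_pM (normc_ge0 _) (normc_ge0 _) zhr IHn) zn) _.
by rewrite [(2 * r) ^+ n.+1]exprS le_eqVlt; apply/orP; left; apply/eqP; ring.
Qed.

Lemma is_derive_power_series C B a z : 0 < B -> geom_bounded C B a ->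
  normc z < (4 * B)^-1 ->
  is_derive z 1 (power_series a) (power_series (deriv_coef a) z).
Proof.
move=> B0 aB zB; apply/is_derive_normP => -[e e'].
rewrite ltcE /= => /andP[/eqP -> e0].
have C0 : 0 <= C by have := le_trans (normc_ge0 _) (aB 0); rewrite expr0 mulr1.
(* With this [r], B * (2 * r) = 1/2, so the second-order remainders are dominated by a geometric
   series of ratio 1/2. It is also the radius (2 * (2 * B))^-1 on which the derived series is known
   to converge. *)
pose r := (4 * B)^-1.
have r0 : 0 < r by rewrite invr_gt0 mulr_gt0.
(* The total remainder is at most M |h|^2. The radius below uses [M + 1], which is positive even
   when [M] is 0. *)
pose M := 2 * (C / r ^+ 2).
have M0 : 0 <= M by rewrite mulr_ge0 // divr_ge0 // exprn_ge0 // ltW.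
apply/near_normcP; exists (Num.min (r - normc z) (e / (M + 1))).
  by rewrite lt_min subr_gt0 zB divr_gt0 // ltr_wpDl.
move=> h; rewrite subr0 lt_min => /andP[hr he].
have zr : normc z <= r by exact: ltW.
have zhr : normc (z + h) <= r.
  by apply: le_trans (le_normcD _ _) _; rewrite -lerBrDl ltW.
have rB : r <= (2 * B)^-1.
  rewrite lef_pV2 ?posrE ?mulr_gt0 //; apply: ler_wpM2r; first exact: ltW.
  by rewrite ler_nat.
have s1 := power_series_sums B0 aB (le_trans zhr rB).
have s2 := power_series_sums B0 aB (le_trans zr rB).
have s3 : sums (fun n => a n * (n%:R * h * z ^+ n.-1)) (h * power_series (deriv_coef a) z).
  have := power_series_sums (mulr_gt0 (ltr0n R 2) B0) (geom_bounded_deriv B0 aB).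
  have -> : 2 * (2 * B) = 4 * B by ring.
  move=> /(_ z zr) /sums_shift /(sumsZ (k := h)); apply: eq_sums => -[|n] /=.
    by rewrite !mul0r !mulr0.
  by rewrite /deriv_coef; ring.
have s := sumsB (sumsB s1 s2) s3.
have wb n : normc (a n * (z + h) ^+ n - a n * z ^+ n - a n * (n%:R * h * z ^+ n.-1))
    <= (C * (normc h ^+ 2 / r ^+ 2)) * 2^-1 ^+ n.
  rewrite -!mulrBr normcM.
  apply: le_trans (ler_pM (normc_ge0 _) (normc_ge0 _) (aB n) (normc_taylor2 n r0 zr zhr)) _.
  have -> : 2^-1 = B * (2 * r) by rewrite /r; field; rewrite gt_eqF.
  by rewrite !exprMn le_eqVlt; apply/orP; left; apply/eqP; ring.
have [_] := dominated_half wb; rewrite (sums_limn s) => H.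
rewrite !normc_norm -[Complex e 0]/(e%:C) -rmorphM lecR; apply: le_trans H _.
have -> : 2 * (C * (normc h ^+ 2 / r ^+ 2)) = M * normc h * normc h.
  by rewrite /M; ring.
rewrite ler_wpM2r ?normc_ge0 //.
apply: (@le_trans _ _ ((M + 1) * normc h)).
  by rewrite ler_wpM2r ?normc_ge0 // lerDl.
by rewrite mulrC -ler_pdivlMr ?ltW // ltr_wpDl.
Qed.

End PowerSeries.

(** * The Gauss series as a solution at 0 *)

Section HypergeometricSeries.
Variable R : realType.
Local Notation K := (R[i] : numFieldType).
Implicit Types (a b c z : K).

Lemma pochhammerS a n : pochhammer a n.+1 = pochhammer a n * (a + n%:R).
Proof. by rewrite /pochhammer big_ord_recr. Qed.

Lemma hyp2F1_coef0 a b c : hyp2F1_coef a b c 0 = 1.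
Proof. by rewrite /hyp2F1_coef /pochhammer !big_ord0 !mul1r invr1. Qed.

Lemma pochhammer_gt0 a n : 0 < a -> 0 < pochhammer a n.
Proof.
move=> a0; rewrite /pochhammer; apply: prodr_gt0 => i _.
by rewrite ltr_wpDr.
Qed.

Lemma hyp2F1_coefS a b c n : 0 < c ->
  hyp2F1_coef a b c n.+1 =
  hyp2F1_coef a b c n * ((a + n%:R) * (b + n%:R) / ((c + n%:R) * n.+1%:R)).
Proof.
move=> c0; rewrite /hyp2F1_coef !pochhammerS factS natrM.
have p0 : pochhammer c n != 0 by rewrite gt_eqF // pochhammer_gt0.
have cn0 : c + n%:R != 0 by rewrite gt_eqF // ltr_wpDr.
have f0 : n`!%:R != 0 :> K by rewrite pnatr_eq0 -lt0n fact_gt0.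
have n0 : n.+1%:R != 0 :> K by rewrite pnatr_eq0.
by field; rewrite nat1r p0 cn0 f0 n0.
Qed.

(** The order of R[i] forces real parameters, and the ratio of consecutive coefficients is (a +
    n)/(c + n) times (b + n)/(1 + n), both factors in [0, 1]. All the series of the theorem satisfy
    these hypotheses. *)
Lemma hyp2F1_coef_itv a b c n : 0 < a <= c -> 0 < b <= 1 ->
  0 <= hyp2F1_coef a b c n <= 1.
Proof.
move=> /andP[a0 ac] /andP[b0 b1]; have c0 := lt_le_trans a0 ac.
elim: n => [|n /andP[IH0 IH1]]; first by rewrite hyp2F1_coef0 ler01 lexx.
have an : 0 <= a + n%:R by rewrite addr_ge0 // ltW.
have bn : 0 <= b + n%:R by rewrite addr_ge0 // ltW.
have cn : 0 < c + n%:R by rewrite ltr_wpDr.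
have q0 : 0 <= (a + n%:R) * (b + n%:R) / ((c + n%:R) * n.+1%:R).
  by rewrite divr_ge0 ?mulr_ge0 // ltW.
have q1 : (a + n%:R) * (b + n%:R) / ((c + n%:R) * n.+1%:R) <= 1.
  rewrite ler_pdivrMr ?mulr_gt0 // mul1r; apply: ler_pM => //.
    by rewrite lerD2r.
  by rewrite -natr1 addrC lerD2l.
rewrite hyp2F1_coefS // mulr_ge0 //=.
by apply: le_trans (ler_pM IH0 q0 IH1 q1) _; rewrite mulr1.
Qed.

Lemma hyp2F1_coef_bounded a b c : 0 < a <= c -> 0 < b <= 1 ->
  geom_bounded 1 1 (hyp2F1_coef a b c).
Proof.
move=> ha hb n; have /andP[A0 A1] := hyp2F1_coef_itv n ha hb.
rewrite expr1n mulr1 -lecR -normc_norm ger0_norm //.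
Qed.

Lemma hyp2F1_at0 a b c : hyp2F1 a b c 0 = 1.
Proof.
rewrite /hyp2F1; apply: sums_limn.
rewrite /sums -cvg_shiftS; apply: cvg_near_cst; near=> n.
rewrite seriesEnat /= big_nat_recl //= expr0 hyp2F1_coef0 mulr1.
by rewrite big1 ?addr0 // => i _; rewrite expr0n /= mulr0.
Unshelve. all: by end_near. Qed.

Lemma hyp2F1_solution a b c : 0 < a <= c -> 0 < b <= 1 ->
  hypergeometric_solution_near a b c 0 (hyp2F1 a b c).
Proof.
move=> ha hb; have c0 : 0 < c by case/andP: ha => a0; exact: lt_le_trans.
set A := hyp2F1_coef a b c.
have B0 := hyp2F1_coef_bounded ha hb; rewrite -/A in B0.
have B1 := geom_bounded_deriv ltr01 B0.
have two0 : 0 < 2 * 1 :> R by [].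
have four0 : 0 < 2 * (2 * 1) :> R by [].
have B2 := geom_bounded_deriv two0 B1.
apply/solution_nearP.
exists (power_series (deriv_coef A)), (power_series (deriv_coef (deriv_coef A))).
(* The series and its first two derivatives have geometric constants B = 1, 2, 4. Differentiating
   the second needs |z| < 1/(4 * 2) and summing the third |z| <= 1/(2 * 4), hence 1/8. *)
apply/near_normcP; exists (8^-1 : R) => // z; rewrite subr0 => z8.
have z4 : normc z < (4 * 1)^-1 by apply: lt_le_trans z8 _; lra.
have z2 : normc z <= (2 * 1)^-1 by apply: ltW; apply: lt_le_trans z8 _; lra.
split.
- exact: is_derive_power_series ltr01 B0 z4.
- apply: (is_derive_power_series two0 B1).
  by apply: lt_le_trans z8 _; lra.
have s0 := power_series_sums ltr01 B0 z2.
have s1 : sums (fun n => deriv_coef A n * z ^+ n) (power_series (deriv_coef A) z).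
  by apply: (power_series_sums two0 B1); apply: ltW; apply: lt_le_trans z8 _; lra.
have s2 : sums (fun n => deriv_coef (deriv_coef A) n * z ^+ n)
    (power_series (deriv_coef (deriv_coef A)) z).
  by apply: (power_series_sums four0 B2); apply: ltW; apply: lt_le_trans z8 _; lra.
rewrite -/(power_series _ _) in s0.
have -> : hyp2F1 a b c z = power_series A z by [].
move: s0 s1 s2; set F := power_series A z; set F1 := power_series (deriv_coef A) z.
set F2 := power_series _ z => s0 s1 s2.
(* [t1], [t2], [t3] expand z F', z F'' and z^2 F'' with the index shifted back to z^n. The equation
   then reduces, coefficient by coefficient, to the recurrence [hyp2F1_coefS]. *)
have t1 : sums (fun n => n%:R * A n * z ^+ n) (z * F1).
  apply: eq_sums (sumsZ (k := z) (sums_shift s1)) => -[|n].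
    by rewrite !mul0r mulr0.
  by rewrite /deriv_coef exprS; ring.
have t2 : sums (fun n => n%:R * (n%:R + 1) * A n.+1 * z ^+ n) (z * F2).
  apply: eq_sums (sumsZ (k := z) (sums_shift s2)) => -[|n].
    by rewrite !mul0r mulr0.
  by rewrite /deriv_coef exprS natr1; ring.
have t3 : sums (fun n => n%:R * (n%:R - 1) * A n * z ^+ n) (z * (z * F2)).
  apply: eq_sums (sumsZ (k := z) (sums_shift t2)) => -[|n].
    by rewrite !mul0r mulr0.
  by rewrite exprS -natr1; ring.
have total := sumsB (sumsD (sumsB t2 t3) (sumsB (sumsZ (k := c) s1)
  (sumsZ (k := a + b + 1) t1))) (sumsZ (k := a * b) s0).
transitivity (z * F2 - z * (z * F2) + (c * F1 - (a + b + 1) * (z * F1)) - a * b * F).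
  by ring.
apply: sums_unique total _; apply: sums0 => n.
have cn : c + n%:R != 0 by rewrite gt_eqF // ltr_wpDr.
by rewrite /deriv_coef /A hyp2F1_coefS // -natr1; field; rewrite ?nat1r ?natr1 cn pnatr_eq0.
Qed.

End HypergeometricSeries.

(** * Complex exponential and logarithm *)

Section LocalInverse.
Variable K : numFieldType.

Lemma is_derive_local_inverse (f g : K -> K) (x m : K) :
  {for x, continuous f} -> (\forall z \near x, g (f z) = z) ->
  is_derive (f x) 1 g m -> m != 0 -> is_derive x 1 f m^-1.
Proof.
move=> fc gf /is_derive_normP dg m0; apply/is_derive_normP => e e0.
have gfx : g (f x) = x by exact: nbhs_singleton gf.
have m_gt0 : 0 < `|m| by rewrite normr_gt0.
(* The differentiability of [g] is used with two tolerances. [e1] bounds the increment [k] of [f] by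
   2/|m| times |h|; [e2] is chosen so that this bound turns e |m|^2 / 2 * |k| into at most e |h|
   |m|. *)
have e1 : 0 < `|m| / 2 by rewrite divr_gt0.
have e2 : 0 < e * `|m| ^+ 2 / 2 by rewrite divr_gt0 // mulr_gt0 // exprn_gt0.
have kc (P : K -> Prop) : (\forall k \near (0 : K), P k) ->
    \forall h \near (0 : K), P (f (x + h) - f x).
  move=> P0; have : \forall y \near f x, P (y - f x).
    by apply/nbhs0P; move: P0; apply: filterS => k Pk /=; rewrite addrC addKr.
  by move=> /fc /nbhs0P.
have H1 := kc _ (dg _ e1); have H2 := kc _ (dg _ e2).
have gf' : \forall h \near (0 : K), g (f (x + h)) = x + h.
  by move/nbhs0P: gf.
near=> h.
have gh : g (f (x + h)) = x + h by near: h.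
have : `|g (f x + (f (x + h) - f x)) - g (f x) - (f (x + h) - f x) * m|
    <= `|m| / 2 * `|f (x + h) - f x| by near: h; exact: H1.
have : `|g (f x + (f (x + h) - f x)) - g (f x) - (f (x + h) - f x) * m|
    <= e * `|m| ^+ 2 / 2 * `|f (x + h) - f x| by near: h; exact: H2.
have -> : f x + (f (x + h) - f x) = f (x + h) by ring.
set k := f (x + h) - f x; rewrite gh gfx.
have -> : x + h - x - k * m = h - k * m by ring.
move=> h2 h1.
have kh : `|k| <= 2 / `|m| * `|h|.
  have : `|k| * `|m| <= `|h| + `|m| / 2 * `|k|.
    rewrite -normrM -[k * m](subKr h); apply: le_trans (ler_normB _ _) _.
    by rewrite lerD2l.
  rewrite [_ * `|m|]mulrC -lerBlDr.
  have -> : `|m| * `|k| - `|m| / 2 * `|k| = `|m| / 2 * `|k| by field.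
  rewrite -ler_pdivlMl // invf_div.
  by [].
have -> : k - h * m^-1 = (h - k * m) * - m^-1 by field.
rewrite normrM normrN normfV ler_pdivrMr //.
apply: le_trans h2 _.
have -> : e * `|h| * `|m| = e * `|m| ^+ 2 / 2 * (2 / `|m| * `|h|).
  by field; rewrite gt_eqF.
by rewrite ler_wpM2l // ltW.
Unshelve. all: by end_near. Qed.

End LocalInverse.

(** * Derivatives of the complex exponential, logarithm and powers *)

Section ComplexExponential.
Variable R : realType.
Local Notation K := (R[i] : numFieldType).
Implicit Types (z w : K).

Lemma cexpD z w : cexp (z + w) = cexp z * cexp w.
Proof.
case: z => a b; case: w => c d; rewrite /cexp /=.
by rewrite expRD cosD sinD; simpc; congr Complex; ring.
Qed.

Lemma cexp0 : cexp (0 : K) = 1.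
Proof. by rewrite /cexp /= expR0 cos0 sin0 mulr0 mulr1. Qed.

Lemma cexp_neq0 z : cexp z != 0.
Proof.
apply/eqP => z0; have /eqP := cexpD z (- z).
by rewrite subrr cexp0 z0 mul0r oner_eq0.
Qed.

Lemma is_derive_cexp0 : is_derive (0 : K) 1 (@cexp R : K -> K) 1.
Proof.
apply/is_derive_normP => _ /complex_gt0P[e e0 ->].
(* The real and imaginary parts of the error each cost 2 + 1 units of (e/6) |z|, the 2 being the
   bound on [expR x] ensured by the [1] in the minimum below. *)
have e6 : 0 < e / 6 by rewrite divr_gt0.
have /is_derive_normP /(_ _ e6) /nbhs_norm0P [d1 d10 H1] := is_derive_expR (0 : R).
have /is_derive_normP /(_ _ e6) /nbhs_norm0P [d2 d20 H2] := is_derive_cos (0 : R).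
have /is_derive_normP /(_ _ e6) /nbhs_norm0P [d3 d30 H3] := is_derive_sin (0 : R).
have m0 : 0 < Num.min (e / 6) 1 by rewrite lt_min e6 ltr01.
have /cvgrPdist_le /(_ _ m0) /nbhs_norm0P [d4 d40 H4] := @continuous_expR R 0.
rewrite /= in d10 d20 d30 d40.
apply/near_normcP; exists (Num.min (Num.min d1 d2) (Num.min d3 d4)).
  by rewrite !lt_min d10 d20 d30 d40.
move=> z; rewrite subr0 add0r cexp0 mulr1; case: z => x y; rewrite !lt_min => /andP[/andP[h1 h2] /andP[h3 h4]].
set n := normc _ in h1 h2 h3 h4.
have xn : `|x| <= n := Re_le_normc (Complex x y).
have yn : `|y| <= n := Im_le_normc (Complex x y).
have [E S C [E1 E2]] : [/\ `|expR x - 1 - x| <= e / 6 * `|x|,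
    `|sin y - y| <= e / 6 * `|y|, `|cos y - 1| <= e / 6 * `|y| &
    `|1 - expR x| <= e / 6 /\ `|1 - expR x| <= 1].
  have := H1 x (le_lt_trans xn h1); have := H2 y (le_lt_trans yn h2).
  have := H3 y (le_lt_trans yn h3); have := H4 x (le_lt_trans xn h4).
  rewrite /= !add0r sin0 cos0 expR0 oppr0 mulr0 !subr0 !mulr1 addr0 le_min.
  by move=> /andP[? ?] ? ? ?; split.
rewrite !normc_norm -rmorphM lecR.
have n0 : 0 <= n := normc_ge0 (Complex x y).
have X2 : `|expR x| <= 2.
  have -> : expR x = 1 - (1 - expR x) by ring.
  by apply: le_trans (ler_normB _ _) _; rewrite normr1; lra.
apply: le_trans (normc_le_ReIm _) _; rewrite /cexp.
rewrite -[X in Re X]/(Complex _ _) /=.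
have -> : expR x * cos y - 1 - x = expR x * (cos y - 1) + (expR x - 1 - x) by ring.
have -> : expR x * sin y - 0 - y = expR x * (sin y - y) - (1 - expR x) * y by ring.
have T1 : `|expR x * (cos y - 1)| <= 2 * (e / 6 * n).
  rewrite normrM; apply: ler_pM => //; apply: le_trans C _.
  by apply: ler_wpM2l => //; exact: ltW.
have T2 : `|expR x * (sin y - y)| <= 2 * (e / 6 * n).
  rewrite normrM; apply: ler_pM => //; apply: le_trans S _.
  by apply: ler_wpM2l => //; exact: ltW.
have T3 : `|expR x - 1 - x| <= e / 6 * n.
  by apply: le_trans E _; apply: ler_wpM2l => //; exact: ltW.
have T4 : `|(1 - expR x) * y| <= e / 6 * n by rewrite normrM; apply: ler_pM.
have T5 := ler_normD (expR x * (cos y - 1)) (expR x - 1 - x).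
have T6 := ler_normB (expR x * (sin y - y)) ((1 - expR x) * y).
have -> : e * n = 6 * (e / 6 * n) by field.
set q := e / 6 * n in T1 T2 T3 T4 *.
by lra.
Qed.

Lemma is_derive_cexp z : is_derive z 1 (@cexp R : K -> K) (cexp z).
Proof.
apply/is_derive_normP => e e0.
have ez : 0 < e / `|cexp z| by rewrite divr_gt0 // normr_gt0 cexp_neq0.
have /is_derive_normP /(_ _ ez) := is_derive_cexp0; apply: filterS => h.
rewrite add0r cexp0 mulr1 cexpD => H.
have -> : cexp z * cexp h - cexp z - h * cexp z = cexp z * (cexp h - 1 - h) by ring.
rewrite normrM; apply: le_trans (ler_wpM2l (normr_ge0 _) H) _.
by rewrite mulrA mulrCA divff ?mulr1 // normr_eq0 cexp_neq0.
Qed.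

(** Half-angle computation: for t = b/(s + a) with s = |z| one has 1 + t^2 = 2 s/(s + a), so cos^2
    (atan t) = (s + a)/(2 s), and the double-angle formulas give back a/s and b/s. *)
Lemma cexp_clog z : 0 < Re z -> cexp (clog z) = z.
Proof.
case: z => a b /= a0; rewrite /cexp /clog /carg ltNge (ltW a0) andbF.
set s := Num.sqrt _.
have s0 : 0 < s by rewrite sqrtr_gt0 ltr_pwDl ?exprn_gt0 ?sqr_ge0.
have sE : b ^+ 2 = (s - a) * (s + a).
  by rewrite -subr_sqr sqr_sqrtr ?addr_ge0 ?sqr_ge0 // addrC addKr.
have sa0 : s + a != 0 by rewrite gt_eqF // addr_gt0.
set t := b / (s + a).
have tE : 1 + t ^+ 2 = 2 * s / (s + a) by rewrite /t expr_div_n sE; field.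
have t0 : 0 < 1 + t ^+ 2 by rewrite ltr_pwDl ?sqr_ge0.
have c2 : cos (atan t) ^+ 2 = (s + a) / (2 * s).
  rewrite cos_atan exprVn sqr_sqrtr ?ltW // tE invf_div //.
have sn : sin (atan t) = t * cos (atan t).
  rewrite -[X in X * _]atanK /tan divfK // cos_atan invr_eq0.
  by rewrite gt_eqF // sqrtr_gt0.
rewrite lnK ?posrE // mulr_natl cos_mulr2n sin_mulr2n sn.
rewrite -mulr_natr c2 mulrCA -expr2 c2 -[_ *+ 2]mulr_natr /t.
by congr Complex; field; rewrite ?sa0 gt_eqF.
Qed.

Lemma lipschitz_cvg_at (f : K -> R) z : (forall w, `|f z - f w| <= normc (z - w)) ->
  (f @ nbhs z --> f z).
Proof.
move=> Hf; apply/cvgrPdist_le => e e0; apply/near_normcP; exists e => // w wz.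
by apply: le_trans (Hf w) _; rewrite -normcN opprB ltW.
Qed.

Lemma cvg_Re z : (fun w : K => Re w) @ nbhs z --> Re z.
Proof.
by apply: (lipschitz_cvg_at (f := fun w : K => Re w)) => w; rewrite -raddfB; exact: Re_le_normc.
Qed.

Lemma cvg_Im z : (fun w : K => Im w) @ nbhs z --> Im z.
Proof.
by apply: (lipschitz_cvg_at (f := fun w : K => Im w)) => w; rewrite -raddfB; exact: Im_le_normc.
Qed.

Lemma cvg_normc z : (fun w : K => normc w) @ nbhs z --> normc z.
Proof.
apply: (lipschitz_cvg_at (f := fun w : K => normc w)) => w.
have tri (u v : K) : normc u - normc v <= normc (u - v).
  by rewrite lerBlDr -{1}(subrK v u); exact: le_normcD.
by rewrite ler_norml tri lerNl opprB andbT -[normc (z - w)]normcN opprB.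
Qed.

Lemma near_Re_gt0 z : 0 < Re z -> \forall w \near z, 0 < Re (w : K).
Proof.
move=> z0; apply/near_normcP; exists (Re z) => // w wz.
have := le_lt_trans (Re_le_normc _) wz; rewrite raddfB /= ltr_norml => /andP[+ _].
by rewrite ltrBrDr addNr.
Qed.

Lemma continuous_clog z : 0 < Re z -> {for z, continuous (@clog R : K -> K)}.
Proof.
move=> z0.
have HR : (fun w : K => Re (clog w)) @ nbhs z --> Re (clog z).
  have -> : Re (clog z) = ln (normc z) by case: {z0}z.
  apply: (@cvg_trans _ ((fun w : K => ln (normc w)) @ nbhs z)).
    by apply: near_eq_cvg; apply: nearW => -[].
  apply: (cvg_comp _ (@ln R) (cvg_normc (z := z))); apply: continuous_ln.
  by apply: lt_le_trans z0 _; apply: le_trans (ler_norm _) (Re_le_normc z).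
have argE (w : K) : 0 < Re w -> Im (clog w) = 2 * atan (Im w / (normc w + Re w)).
  by case: w => a b /= a0; rewrite /carg ltNge (ltW a0) andbF.
have HI : (fun w : K => Im (clog w)) @ nbhs z --> Im (clog z).
  rewrite argE //.
  apply: (@cvg_trans _ ((fun w : K => 2 * atan (Im w / (normc w + Re w))) @ nbhs z)).
    apply: near_eq_cvg; move: (near_Re_gt0 z0); apply: filterS => w w0.
    by rewrite argE.
  apply: cvgM; first exact: cvg_cst.
  apply: (cvg_comp (fun w : K => Im w / (normc w + Re w)) (@atan R));
    last exact: continuous_atan.
  apply: cvgM; first exact: cvg_Im.
  apply: cvgV; first by rewrite gt_eqF // ltr_wpDl ?normc_ge0.
  by apply: cvgD; [exact: cvg_normc|exact: cvg_Re].
exact: (@cvg_complex_ReIm R K (nbhs z) (nbhs_filter z) (@clog R) (clog z) HR HI).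
Qed.

Lemma is_derive_clog z : 0 < Re z -> is_derive z 1 (@clog R : K -> K) z^-1.
Proof.
move=> z0; have zz := cexp_clog z0.
apply: (@is_derive_local_inverse _ _ (@cexp R)).
- exact: continuous_clog.
- by move: (near_Re_gt0 z0); apply: filterS => w; exact: cexp_clog.
- by rewrite -{2}zz; exact: is_derive_cexp.
- by rewrite -zz cexp_neq0.
Qed.

Lemma is_derive_cpow (f : K -> K) (w x l : K) : is_derive x 1 f l -> 0 < Re (f x) ->
  is_derive x 1 (fun y => cpow (f y) w : K) (cpow (f x) w * (w * (l / f x))).
Proof.
move=> df fx.
have dl := is_derive1_comp_field df (is_derive_clog fx).
have dw := fun_is_deriveM (is_derive_cst w x 1) dl.
apply: is_derive_eq (is_derive1_comp_field dw (is_derive_cexp _)) _.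
by rewrite /= /cst /cpow; ring.
Qed.

(* Any branch of the logarithm of g has derivative g' / g. *)
Lemma is_derive_log_branch (L g : K -> K) (x l : K) : derivable L x 1 ->
  (\forall z \near x, cexp (L z) = g z) -> is_derive x 1 g l ->
  is_derive x 1 L (l / g x).
Proof.
move=> dL Lg dg; have {dL}dL := derivableP dL.
have gx : cexp (L x) = g x by exact: nbhs_singleton Lg.
have dcL := is_derive1_comp_field dL (is_derive_cexp _).
have [_ E1] :=
  @near_eq_is_derive _ _ _ (@cexp R \o L : K -> K) g x 1 _ Lg dcL; have [_ E2] := dg.
apply: is_derive_eq dL _; apply: (mulfI (cexp_neq0 (L x))).
by rewrite -E1 E2 gx mulrCA divff ?mulr1 // -gx cexp_neq0.
Qed.

End ComplexExponential.

(** * Uniqueness at a regular singular point *)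

Section Uniqueness.
Variable R : realType.
Local Notation K := (R[i] : numFieldType).
Implicit Types (a b c x z : K) (F D : K -> K) (t : R).

(** The variable is real and the values are complex, so the derivative along the ray is stated as an
    estimate. Its real and imaginary parts then yield derivatives of real functions. *)
Lemma is_derive_ray_normc F x (l : K) t : is_derive (t%:C * x : K) 1 F l ->
  forall e : R, 0 < e -> \forall h \near (0 : R),
    normc (F ((t + h)%:C * x) - F (t%:C * x) - h%:C * (x * l)) <= e * `|h|.
Proof.
move=> /is_derive_normP dF e e0.
have x1 : 0 < normc x + 1 by rewrite ltr_wpDl ?normc_ge0.
have e1 : 0 < (e / (normc x + 1))%:C :> K by rewrite ltcR divr_gt0.
have /near_normcP [d d0 Hd] := dF _ e1.
apply/nbhs_norm0P; exists (d / (normc x + 1)) => /=; first by rewrite divr_gt0.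
move=> h; rewrite /= ltr_pdivlMr // => hd.
have hx : normc (h%:C * x : K) < d.
  apply: le_lt_trans hd; rewrite normcM normc_real; apply: ler_wpM2l => //.
  by rewrite lerDl.
have := Hd (h%:C * x); rewrite subr0 => /(_ hx).
rewrite !normc_norm -rmorphM lecR.
have -> : t%:C * x + h%:C * x = (t + h)%:C * x by rewrite rmorphD mulrDl.
rewrite -mulrA => /le_trans; apply.
rewrite normcM normc_real mulrA mulrAC; apply: ler_wpM2r => //.
by rewrite mulrAC ler_pdivrMr // ler_wpM2l ?(ltW e0) // lerDl.
Qed.

Lemma is_derive_ray_Re F x (l : K) t : is_derive (t%:C * x : K) 1 F l ->
  is_derive t 1 (fun s : R => Re (F (s%:C * x))) (Re (x * l)).
Proof.
move=> /is_derive_ray_normc H; apply/is_derive_normP => e e0.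
move: (H e e0); apply: filterS => h; apply: le_trans.
apply: le_trans (Re_le_normc _); rewrite !raddfB /=.
suff -> : Re (h%:C * (x * l)) = h * Re (x * l) by [].
by case: (x * l) => u v /=; rewrite mul0r subr0.
Qed.

Lemma is_derive_ray_Im F x (l : K) t : is_derive (t%:C * x : K) 1 F l ->
  is_derive t 1 (fun s : R => Im (F (s%:C * x))) (Im (x * l)).
Proof.
move=> /is_derive_ray_normc H; apply/is_derive_normP => e e0.
move: (H e e0); apply: filterS => h; apply: le_trans.
apply: le_trans (Im_le_normc _); rewrite !raddfB /=.
suff -> : Im (h%:C * (x * l)) = h * Im (x * l) by [].
by case: (x * l) => u v /=; rewrite mul0r addr0.
Qed.

Lemma mvt_bound (f df : R -> R) (M t : R) : 0 <= t <= 1 ->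
  (forall s : R, 0 <= s <= 1 -> is_derive s 1 f (df s)) -> f 0 = 0 ->
  (forall s : R, 0 <= s <= 1 -> `|df s| <= M) -> `|f t| <= M.
Proof.
move=> /andP[t0 t1] fd f0 dfM.
have sub s : 0 <= s <= t -> 0 <= s <= 1.
  by move=> /andP[-> /le_trans]; apply.
have [s||s st] := @MVT_segment R f df 0 t t0.
- by rewrite in_itv /= => /andP[s0 st]; apply: fd; rewrite sub // !ltW.
- apply: (derivable_within_continuous (f := f)) => s; rewrite in_itv /= => st.
  by have [] := fd s (sub s st).
rewrite f0 !subr0 => ->; rewrite normrM (ger0_norm t0).
move: st; rewrite in_itv /= => /sub /dfM st.
apply: le_trans (ler_pM (normr_ge0 _) t0 st t1) _.
by rewrite mulr1.
Qed.

(** The maximum may be at the end point 1, so only points to the left are compared; this gives a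
    sign for the derivative, not its vanishing. *)
Lemma deriv_at_right_max (f : R -> R) (l t : R) : 0 < t <= 1 ->
  is_derive t 1 f l -> (forall s : R, 0 <= s <= 1 -> f s <= f t) -> 0 <= l.
Proof.
move=> /andP[t0 t1] /is_derive_normP df fmax; rewrite leNgt; apply/negP => l0.
have e0 : 0 < - l / 2 by rewrite divr_gt0 // oppr_gt0.
have /nbhs_norm0P [d /= d0 Hd] := df _ e0.
pose k := Num.min (d / 2) t.
have k0 : 0 < k by rewrite lt_min divr_gt0.
have kd : k < d.
  by rewrite gt_min ltr_pdivrMr // mulr_natr mulr2n ltr_pwDl.
have kt : k <= t by rewrite ge_min lexx orbT.
have := Hd (- k); rewrite /= normrN gtr0_norm // => /(_ kd).
rewrite ler_norml => /andP[H _].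
have H2 : f (t - k) <= f t.
  by apply: fmax; rewrite subr_ge0 kt lerBlDr (le_trans t1) // lerDl ltW.
have : 0 < k * (- l) by rewrite mulr_gt0 // oppr_gt0.
move: H; have -> : - (- l / 2 * k) = - (k * - l) / 2 by field.
have -> : - k * l = k * - l by ring.
by set p := k * - l; move: (f (t - k)) H2 => ft H2; lra.
Qed.

(** The mean value theorem is applied to the two coordinates separately, whence the factor 2. *)
Lemma normc_ray_bound (F F1 : K -> K) x (M : R) :
  (forall t : R, 0 <= t <= 1 -> is_derive (t%:C * x : K) 1 F (F1 (t%:C * x))) ->
  F 0 = 0 -> (forall t : R, 0 <= t <= 1 -> normc (F1 (t%:C * x)) <= M) ->
  forall t : R, 0 <= t <= 1 -> normc (F (t%:C * x)) <= 2 * (normc x * M).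
Proof.
move=> dF F0 F1M t t01; apply: le_trans (normc_le_ReIm _) _.
rewrite mulr_natl mulr2n; apply: lerD.
- apply: (mvt_bound (f := fun s : R => Re (F (s%:C * x)))
    (df := fun s : R => Re (x * F1 (s%:C * x)))) => // [s s01||s s01].
  + exact/is_derive_ray_Re/dF.
  + by rewrite mul0r F0.
  + apply: le_trans (Re_le_normc _) _; rewrite normcM.
    by apply: ler_wpM2l; [exact: normc_ge0|exact: F1M].
- apply: (mvt_bound (f := fun s : R => Im (F (s%:C * x)))
    (df := fun s : R => Im (x * F1 (s%:C * x)))) => // [s s01||s s01].
  + exact/is_derive_ray_Im/dF.
  + by rewrite mul0r F0.
  + apply: le_trans (Im_le_normc _) _; rewrite normcM.
    by apply: ler_wpM2l; [exact: normc_ge0|exact: F1M].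
Qed.

Lemma normc_sqr z : normc z ^+ 2 = Re z ^+ 2 + Im z ^+ 2.
Proof. by case: z => u v /=; rewrite sqr_sqrtr // addr_ge0 ?sqr_ge0. Qed.

(** Solving the equation for z D'' gives -c D' + W with W = (a b D + (a + b + 1 - c) z D')/(1 - z),
    which is of order [delta]. In the constant 4, one factor 2 bounds 1/(1 - z) and the other counts
    the two coordinates. *)
Lemma ode_energy a b (g : R) z (d d1 d2 : K) (delta : R) :
  z * (1 - z) * d2 + (g%:C - (a + b + 1) * z) * d1 - a * b * d = 0 ->
  normc z <= delta -> delta <= 2^-1 -> normc d <= 2 * (delta * normc d1) ->
  Re d1 * Re (z * d2) + Im d1 * Im (z * d2) <=
    (4 * delta * (2 * normc (a * b) + normc (a + b + 1 - g%:C)) - g) * normc d1 ^+ 2.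
Proof.
move=> ode zd dh dd.
have z1 : 2^-1 <= normc (1 - z).
  have : normc (1 : K) <= normc (1 - z) + normc z.
    by rewrite -{1}(subrK z 1); exact: le_normcD.
  by rewrite normc1 => H; lra.
have z10 : 1 - z != 0.
  by apply/eqP => E; move: z1; rewrite E normc0; apply/negP; rewrite -ltNge invr_gt0.
pose W := (a * b * d + (a + b + 1 - g%:C) * z * d1) / (1 - z).
have zd2 : z * d2 = - (g%:C * d1) + W.
  apply: (mulfI z10); rewrite /W mulrDr [X in _ = _ + X]mulrC divfK //.
  apply/eqP; rewrite -subr_eq0 -[X in _ == X]ode; apply/eqP; ring.
set n := normc d1 in dd *.
have n0 : 0 <= n := normc_ge0 d1.
set A := normc (a * b); set S := normc (a + b + 1 - g%:C).
have A0 : 0 <= A := normc_ge0 _.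
have S0 : 0 <= S := normc_ge0 _.
have d0 : 0 <= delta := le_trans (normc_ge0 z) zd.
have WB : normc W <= 2 * (delta * (2 * A + S) * n).
  rewrite /W normcM normcV mulrC.
  apply: ler_pM; rewrite ?invr_ge0 ?normc_ge0 //.
    by rewrite invf_ple ?posrE // (lt_le_trans _ z1).
  apply: le_trans (le_normcD _ _) _.
  rewrite (normcM (a * b) d) (normcM (_ * z) d1) (normcM _ z) -/A -/n -/S.
  have -> : delta * (2 * A + S) * n = A * (2 * (delta * n)) + S * delta * n by ring.
  apply: lerD; first by apply: ler_wpM2l.
  by apply: ler_wpM2r => //; apply: ler_wpM2l.
have RW : Re d1 * Re W <= n * normc W.
  apply: le_trans (ler_norm _) _; rewrite normrM.
  by apply: ler_pM => //; exact: Re_le_normc.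
have IW : Im d1 * Im W <= n * normc W.
  apply: le_trans (ler_norm _) _; rewrite normrM.
  by apply: ler_pM => //; exact: Im_le_normc.
have nW : n * normc W <= n * (2 * (delta * (2 * A + S) * n)) by exact: ler_wpM2l.
have -> : Re d1 * Re (z * d2) + Im d1 * Im (z * d2) =
    - g * n ^+ 2 + (Re d1 * Re W + Im d1 * Im W).
  rewrite zd2 /n normc_sqr !raddfD /= !raddfN /=.
  by case: (d1) => u v /=; ring.
have -> : (4 * delta * (2 * A + S) - g) * n ^+ 2 =
    - g * n ^+ 2 + 2 * (n * (2 * (delta * (2 * A + S) * n))) by ring.
by rewrite lerD2l mulr_natl mulr2n; apply: lerD; [apply: le_trans RW nW|apply: le_trans IW nW].
Qed.

(* Along a ray from the singular point 0, [c > 0] makes |D'|^2 decrease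
   wherever it reaches a positive maximum, so D' vanishes. *)
Lemma solution_eq0 a b c D : 0 < c -> D 0 = 0 ->
  hypergeometric_solution_near a b c 0 D -> \forall x \near (0 : K), D x = 0.
Proof.
move=> /complex_gt0P[g g0 ->] D0 /solution_nearP [D1 [D2 /near_normcP [r r0 H]]].
set Q := 2 * normc (a * b) + normc (a + b + 1 - g%:C).
have Q0 : 0 <= Q by rewrite addr_ge0 ?mulr_ge0 ?normc_ge0.
(* The bound 1/2 keeps 1 - z away from 0; the other term makes the coefficient [4 * delta * Q - g]
   of [ode_energy] negative. *)
pose delta := Num.min 2^-1 (g / (4 * Q + 1)).
have q1 : 0 < 4 * Q + 1 by rewrite ltr_wpDl // mulr_ge0.
have deltaQ : 4 * delta * Q < g.
  have : delta <= g / (4 * Q + 1) by rewrite ge_min lexx orbT.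
  rewrite ler_pdivlMr // mulrDr mulr1 => E.
  have dp : 0 < delta by rewrite lt_min invr_gt0 ltr0n divr_gt0.
  have -> : 4 * delta * Q = delta * (4 * Q) by ring.
  by set X := delta * _ in E *; lra.
apply/near_normcP; exists (Num.min r delta).
  by rewrite !lt_min r0 invr_gt0 ltr0n divr_gt0.
move=> x; rewrite subr0 lt_min => /andP[xr xd].
have zx t : 0 <= t <= 1 -> normc (t%:C * x : K) <= normc x.
  move=> /andP[t0 t1]; rewrite normcM normc_real ger0_norm //.
  by rewrite ler_piMl ?normc_ge0.
have Ht t : 0 <= t <= 1 -> [/\ is_derive (t%:C * x : K) 1 D (D1 (t%:C * x)),
    is_derive (t%:C * x : K) 1 D1 (D2 (t%:C * x)) &
    (t%:C * x) * (1 - t%:C * x) * D2 (t%:C * x)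
    + (g%:C - (a + b + 1) * (t%:C * x)) * D1 (t%:C * x) - a * b * D (t%:C * x) = 0].
  by move=> t01; apply: H; rewrite subr0 (le_lt_trans (zx t t01)).
pose E (t : R) : R := Re (D1 (t%:C * x)) ^+ 2 + Im (D1 (t%:C * x)) ^+ 2.
pose E' (t : R) : R := 2 * (Re (D1 (t%:C * x)) * Re (x * D2 (t%:C * x))
                 + Im (D1 (t%:C * x)) * Im (x * D2 (t%:C * x))).
have dE (t : R) : 0 <= t <= 1 -> is_derive t 1 E (E' t).
  move=> /Ht [_ d2 _].
  have dR := fun_is_deriveX 2 (is_derive_ray_Re d2).
  have dI := fun_is_deriveX 2 (is_derive_ray_Im d2).
  apply: is_derive_eq (fun_is_deriveD dR dI) _.
  by rewrite /E' /= !expr1; ring.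
have [tm tm01 Emax] : exists2 t, t \in `[0, 1]%R & forall s, s \in `[0, 1]%R -> E s <= E t.
  apply: (EVT_max ler01); apply: (derivable_within_continuous (f := E)) => s.
  by rewrite in_itv /= => /dE [].
rewrite in_itv /= in tm01.
have {}Emax (s : R) : 0 <= s <= 1 -> E s <= E tm.
  by move=> s01; apply: Emax; rewrite in_itv.
pose M := normc (D1 (tm%:C * x)).
have M0 : 0 <= M := normc_ge0 _.
have EM t : E t = normc (D1 (t%:C * x)) ^+ 2 by rewrite normc_sqr.
have D1M (t : R) : 0 <= t <= 1 -> normc (D1 (t%:C * x)) <= M.
  move=> /Emax; rewrite !EM -/M ler_pXn2r // ?nnegrE ?normc_ge0 //.
have DM := normc_ray_bound (fun t t01 => let: And3 p _ _ := Ht t t01 in p) D0 D1M.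
have xd' : normc x <= delta by exact: ltW.
have dh : delta <= 2^-1 by rewrite ge_min lexx.
have {}DM : normc (D (tm%:C * x)) <= 2 * (normc x * M) /\ normc (D x) <= 2 * (normc x * M).
  by split; [exact: DM|have := DM 1; rewrite mul1r; apply; rewrite ler01 lexx].
have [DM1 DM2] := DM.
have [M00|Mn0] := eqVneq M 0.
  apply: eq0_normc; apply/eqP; rewrite eq_le normc_ge0 andbT.
  by move: DM2; rewrite M00 !mulr0.
have Mp : 0 < M by rewrite lt_neqAle eq_sym Mn0.
have [_ _ ode] := Ht _ tm01.
(* At t = 0 the equation reduces to c D'(0) = 0, so a positive maximum of |D'| cannot be attained
   there. *)
have tmp : 0 < tm.
  rewrite lt_neqAle (andP tm01).1 andbT; apply/eqP => tm0.
  move: ode Mn0; rewrite /M -tm0 !mul0r D0 !mulr0 subr0 add0r subr0 => /eqP.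
  rewrite mulf_eq0 => /orP[|/eqP ->]; last by rewrite normc0 eqxx.
  by rewrite -(rmorph0 (real_complex R)) => /eqP[g00]; rewrite g00 ltxx in g0.
have dM : normc (D (tm%:C * x)) <= 2 * (delta * normc (D1 (tm%:C * x))).
  apply: le_trans DM1 _; rewrite -/M; apply: ler_wpM2l => //; exact: ler_wpM2r.
have := ode_energy ode (le_trans (zx tm tm01) xd') dh dM; rewrite -/Q -/M.
have := deriv_at_right_max _ (dE _ tm01) Emax.
rewrite tmp (andP tm01).2 => /(_ isT) E'0.
have -> : Re (D1 (tm%:C * x)) * Re (tm%:C * x * D2 (tm%:C * x)) +
   Im (D1 (tm%:C * x)) * Im (tm%:C * x * D2 (tm%:C * x)) = tm * (E' tm / 2).
  rewrite /E' -mulrA; case: (D1 _) => u v; case: (x * D2 _) => p q /=.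
  by rewrite !mul0r subr0 addr0; field.
(* The energy is nonnegative at the maximum, yet bounded by a negative multiple of M^2. *)
move=> /(le_trans (mulr_ge0 (ltW tmp) (divr_ge0 E'0 (ler0n _ 2)))).
by rewrite pmulr_lge0 ?exprn_gt0 // subr_ge0 leNgt deltaQ.
Qed.

Lemma solution_unique a b c (y1 y2 : K -> K) : 0 < c -> y1 0 = y2 0 ->
  hypergeometric_solution_near a b c 0 y1 ->
  hypergeometric_solution_near a b c 0 y2 -> \forall x \near (0 : K), y1 x = y2 x.
Proof.
move=> c0 y0 /solution_nearP [u1 [u2 H1]] /solution_nearP [v1 [v2 H2]].
have := @solution_eq0 a b c (fun x => y1 x + (- 1) * y2 x) c0.
rewrite y0 mulN1r subrr => /(_ erefl) H.
have : hypergeometric_solution_near a b c 0 (fun x => y1 x + (- 1) * y2 x).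
  apply/solution_nearP; exists (fun x => u1 x + (- 1) * v1 x), (fun x => u2 x + (- 1) * v2 x).
  apply: filterS2 H1 H2 => z [a1 a2 a3] [b1 b2 b3]; split.
  - apply: is_derive_eq (fun_is_deriveD a1 (fun_is_deriveM (is_derive_cst (- 1 : K) z 1) b1)) _.
    by rewrite /cst mul0r add0r.
  - apply: is_derive_eq (fun_is_deriveD a2 (fun_is_deriveM (is_derive_cst (- 1 : K) z 1) b2)) _.
    by rewrite /cst mul0r add0r.
  - by rewrite -[RHS](subrr 0) -{1}a3 -b3; ring.
move=> /H; apply: filterS => x /eqP; rewrite mulN1r subr_eq0 => /eqP.
by [].
Qed.

End Uniqueness.

(** * Ramification of phi3 *)

Section Covering.
Variable K : numClosedFieldType.
Implicit Types (x v : K).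
Let hornerP := (hornerM, horner_exp, hornerD, hornerN, hornerZ, hornerXn, hornerX, hornerC).

(** The zeros of the numerator are 0, 1 and 81/49, where [pole3] takes the values 3^8, 256 and (81 *
    16 / 7)^2. *)
Lemma pole3_neq0_of_num x : (phi3 (K := K)).1.[x] = 0 -> pole3 x != 0.
Proof.
rewrite phi3_numE => /eqP; rewrite oppr_eq0 2!mulf_eq0 !expf_eq0 /= subr_eq0.
move=> /orP[/orP[/eqP ->|/eqP ->]|/eqP u0].
- by rewrite /pole3 !expr0n /= !mulr0 !subr0 add0r expf_neq0 // pnatr_eq0.
- have -> : pole3 1 = 256 :> K by rewrite /pole3; ring.
  by rewrite pnatr_eq0.
- have xE : x = 81 / 49 by apply/eqP; rewrite eq_sym -subr_eq0; apply/eqP;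
    transitivity (- zero3 x / 49); [rewrite /zero3; field|rewrite u0 oppr0 mul0r].
  have -> : pole3 x = (81 * 16 / 7) ^+ 2 by rewrite xE /pole3; field.
  by rewrite expf_neq0 // !mulf_neq0 // ?invr_eq0 pnatr_eq0.
Qed.

Lemma coprimep_phi3 : coprimep (phi3 (K := K)).1 (phi3 (K := K)).2.
Proof.
apply/Pdiv.ClosedField.coprimepP => x /eqP /pole3_neq0_of_num g0.
by rewrite /root phi3_denE mulf_neq0 ?pnatr_eq0 // expf_neq0.
Qed.

Let U : {poly K} := 49 *: 'X - 81%:P.
Let G : {poly K} := 7 ^+ 5 *: 'X^3 - (3 ^+ 3 * 7 ^+ 3) *: 'X^2
  - (19 * 3 ^+ 6) *: 'X + (3 ^+ 8)%:P.

(** A common root of p - v q and p' - v q' is a root of p' q - p q', so the factors on the right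
    locate every multiple point of a fibre. *)
Lemma phi3_wronskian x :
  (phi3 (K := K)).1^`().[x] * (phi3 (K := K)).2.[x]
    - (phi3 (K := K)).1.[x] * (phi3 (K := K)).2^`().[x] =
  - (4 * x * zero3 x ^+ 6 * crit3 x * pole3 x ^+ 2).
Proof.
have UE : U.[x] = zero3 x by rewrite /U !hornerP.
have GE : G.[x] = pole3 x by rewrite /G !hornerP.
have U'E : U^`().[x] = 49 by rewrite /U !poly.derivE !hornerP; ring.
have G'E : G^`().[x] = pole3' x by rewrite /G !poly.derivE !hornerP /pole3' /=; ring.
rewrite phi3_factoredE -/U -/G [(_, _).1]/= [(_, _).2]/=.
(* Only the values of the two factors and of their derivatives matter from here on, so their
   expansions are forgotten. *)
move: U G UE GE U'E G'E => u g UE GE U'E G'E.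
rewrite !(derivN, derivM, derivZ, deriv_exp, derivXsubC, derivXn).
by rewrite !(hornerMn, hornerP) UE GE U'E G'E crit3E /=; ring.
Qed.

Lemma size_phi3_den : size (phi3 (K := K)).2 = 10%N.
Proof.
rewrite phi3_factoredE -/G [X in size X]/= size_scale ?pnatr_eq0 //.
have sG : size G = 4%N.
  have n7 : 7 ^+ 5 != 0 :> K by rewrite expf_neq0 // pnatr_eq0.
  have s3 : size (7 ^+ 5 *: 'X^3 : {poly K}) = 4%N by rewrite size_scale // size_polyXn.
  have s2 : (size (- ((3 ^+ 3 * 7 ^+ 3) *: 'X^2) : {poly K}) < 4)%N.
    by rewrite size_polyN (leq_ltn_trans (size_scale_leq _ _)) // size_polyXn.
  have s1 : (size (- ((19 * 3 ^+ 6) *: 'X) : {poly K}) < 4)%N.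
    by rewrite size_polyN (leq_ltn_trans (size_scale_leq _ _)) // size_polyX.
  have s0 : (size ((3 ^+ 8)%:P : {poly K}) < 4)%N.
    by rewrite (leq_ltn_trans (size_polyC_leq1 _)).
  by rewrite /G !size_polyDl ?s3 // !size_polyDl ?s3.
have G0 : G ^+ 3 != 0 by rewrite expf_neq0 // -size_poly_gt0 sG.
by rewrite -(prednK (n := size _)) ?size_poly_gt0 // size_exp sG.
Qed.

Lemma size_phi3_num : size (phi3 (K := K)).1 = 11%N.
Proof.
rewrite phi3_factoredE -/U [X in size X]/= size_polyN.
have sU : size U = 2%N.
  have s1 : size (49 *: 'X : {poly K}) = 2%N by rewrite size_scale ?size_polyX ?pnatr_eq0.
  by rewrite /U size_polyDl s1 // size_polyN (leq_ltn_trans (size_polyC_leq1 _)).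
have U0 : U ^+ 7 != 0 by rewrite expf_neq0 // -size_poly_gt0 sU.
have sU7 : size (U ^+ 7) = 8%N.
  by rewrite -(prednK (n := size _)) ?size_poly_gt0 // size_exp sU.
rewrite size_monicM // ?sU7 ?monicMl ?monicXn ?monicX ?monicXsubC //.
by rewrite size_Mmonic ?monicXsubC ?size_polyXn ?size_XsubC // monic_neq0 ?monicXn.
Qed.

(** At a multiple root the Wronskian vanishes while [pole3] does not: either x = 0 or [zero3 x = 0],
    which forces v = 0, or [crit3 x = 0], which forces v = 1. *)
Lemma separable_fibre v (P := (phi3 (K := K)).1 - v *: (phi3 (K := K)).2) :
  v != 0 -> v != 1 -> separable_poly P.
Proof.
move=> v0 v1; rewrite unlock; apply/Pdiv.ClosedField.coprimepP => x.
rewrite /root /P derivB derivZ.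
rewrite hornerD (hornerN (v *: _)) hornerZ subr_eq0 => /eqP E.
rewrite hornerD (hornerN (v *: _)) hornerZ subr_eq0; apply/eqP => E'.
have := phi3_wronskian x; rewrite E E'.
have -> (p q : K) : v * p * q - v * q * p = 0 by ring.
have d0 : (phi3 (K := K)).2.[x] != 0.
  rewrite phi3_denE mulf_neq0 ?pnatr_eq0 // expf_neq0 //; apply/eqP => g0.
  by move: E; rewrite phi3_denE g0 expr0n /= !mulr0 => /pole3_neq0_of_num; rewrite g0 eqxx.
have g0 : pole3 x != 0.
  by move: d0; rewrite phi3_denE mulf_eq0 negb_or expf_eq0 /= => /andP[].
have phiv : ratfun_eval phi3 x = v by rewrite /ratfun_eval E mulfK.
move=> /esym/eqP; rewrite oppr_eq0 4!mulf_eq0 !expf_eq0 /= pnatr_eq0 /= (negbTE g0) orbF.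
move=> /orP[/orP[/eqP x0|/eqP u0]|/eqP h0].
- by move: v0; rewrite -phiv phi3E x0 expr0n /= !mul0r oppr0 mul0r eqxx.
- by move: v0; rewrite -phiv phi3E u0 expr0n /= mulr0 oppr0 mul0r eqxx.
- move: v1; rewrite -phiv phi3E; have := crit3_sqr x; rewrite h0 expr0n /= => /esym/eqP.
  rewrite addrC addr_eq0 => /eqP ->; rewrite opprK divff ?eqxx //.
  by rewrite mulf_neq0 ?pnatr_eq0 // expf_neq0.
Qed.

Lemma phi3_covering : P1_covering (phi3 (K := K)) 10.
Proof.
split=> //; first exact: coprimep_phi3.
exists [:: None; Some 0; Some 1] => -[v|]; last by rewrite !inE.
rewrite !inE !negb_or /= => /andP[v0 v1].
pose P := (phi3 (K := K)).1 - v *: (phi3 (K := K)).2.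
have sP : size P = 11%N.
  rewrite /P size_polyDl ?size_phi3_num // size_polyN.
  by rewrite (leq_ltn_trans (size_scale_leq _ _)) // size_phi3_den.
have [s Ps] := closed_field_poly_normal P.
have lP : lead_coef P != 0 by rewrite lead_coef_eq0 -size_poly_gt0 sP.
exists [seq Some x | x <- s]; split.
- rewrite map_inj_uniq; last by move=> ? ? [].
  rewrite -separable_prod_XsubC; have := separable_fibre v0 v1.
  by rewrite -/P Ps unlock derivZ coprimepZl // coprimepZr.
- by rewrite size_map; have := sP; rewrite Ps size_scale // size_prod_XsubC => -[].
case=> [x|]; last first.
  (* The numerator has the larger degree, so infinity lies over infinity and in no finite fibre. *)
  rewrite /P1map size_phi3_num size_phi3_den /=.
  by apply/mapP => -[].
rewrite mem_map; last by move=> ? ? [].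
have -> : (x \in s) = root P x by rewrite Ps rootZ // root_prod_XsubC.
rewrite /P1map /root /P hornerD (hornerN (v *: _)) hornerZ subr_eq0.
(* At a pole [P] takes the value of the numerator, which is nonzero by coprimality. *)
have [d0|d0] := eqVneq (phi3 (K := K)).2.[x] 0.
  rewrite d0 mulr0; apply/eqP => /pole3_neq0_of_num.
  move: d0; rewrite phi3_denE => /eqP; rewrite mulf_eq0 expf_eq0 /= pnatr_eq0 /=.
  by move=> ->.
rewrite -[RHS]/(_ == v) /ratfun_eval -[RHS](inj_eq (mulIf d0)) divfK //.
Qed.

End Covering.

(** * The three identities *)

Section Branches.
Variable K : numFieldType.
Implicit Types x : K.

Lemma ler_natfrac m n p q : (0 < n)%N -> (0 < q)%N -> (m * q <= p * n)%N ->
  m%:R / n%:R <= p%:R / q%:R :> K.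
Proof.
move=> n0 q0 le; rewrite ler_pdivrMr ?ltr0n // mulrAC ler_pdivlMr ?ltr0n //.
by rewrite -!natrM ler_nat.
Qed.

Lemma divr_nat_gt0 m n : (0 < m)%N -> (0 < n)%N -> 0 < m%:R / n%:R :> K.
Proof. by move=> m0 n0; rewrite divr_gt0 ?ltr0n. Qed.

Lemma pole3_normalized0 x :
  1 - 19 / 9 * x - 343 / 243 * x ^+ 2 + 16807 / 6561 * x ^+ 3 = pole3 x / 3 ^+ 8.
Proof.
have -> : (16807 : K) = 7 ^+ 5 by rewrite -natrX; congr (_%:R).
have -> : (6561 : K) = 3 ^+ 8 by rewrite -natrX; congr (_%:R).
by rewrite /pole3; field.
Qed.

Lemma pole3_normalized1 x :
  1 - 141 / 2 * x + 5145 / 32 * x ^+ 2 - 16807 / 256 * x ^+ 3 = pole3 (1 - x) / 256.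
Proof.
have -> : (16807 : K) = 7 ^+ 5 by rewrite -natrX; congr (_%:R).
have -> : (5145 : K) = 15 * 7 ^+ 3 by rewrite -natrX -natrM; congr (_%:R).
by rewrite /pole3; field.
Qed.

Lemma pole3_at0 : pole3 0 = 3 ^+ 8 :> K.
Proof. by rewrite /pole3 !expr0n /= !mulr0 !subr0 add0r. Qed.

Lemma pole3_at1 : pole3 1 = 256 :> K.
Proof. by rewrite /pole3; ring. Qed.

End Branches.

(** * Branches of the prefactors and comparison of solutions at 0 *)

Section Assembly.
Variable R : realType.
Local Notation K := (R[i] : numFieldType).
Implicit Types (x w : K).

Lemma cpow1 w : cpow 1 w = 1.
Proof.
rewrite /cpow.
have -> : clog (1 : K) = 0.
  rewrite /clog /= /carg eqxx ltr10 /= !mul0r atan0 mulr0 expr0n /= addr0 expr1n.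
  by rewrite sqrtr1 ln1.
by rewrite mulr0 cexp0.
Qed.

Lemma near_is_derive_cpow (f df : K -> K) (w x0 : K) :
  (forall x : K, is_derive x 1 f (df x)) -> f x0 = 1 ->
  \forall x \near x0, is_derive (x : K) 1 (fun z => cpow (f z) w : K)
    (cpow (f x) w * (w * (df x / f x))).
Proof.
move=> dfx f1; have fc := is_derive_continuous (dfx x0).
have H : \forall x \near x0, 0 < Re (f x).
  have f0 : 0 < Re (f x0) by rewrite f1 ltr01.
  exact: (fc _ (near_Re_gt0 f0)).
by move: H; apply: filterS => x; exact: is_derive_cpow.
Qed.

Lemma is_derive_scaled_pole3 (k x : K) :
  is_derive x 1 (fun z : K => pole3 z / k) (pole3' x / k).
Proof.
apply: is_derive_eq (fun_is_deriveM (is_derive_pole3 x) (is_derive_cst (k^-1 : K) x 1)) _.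
by rewrite mulr0 addr0.
Qed.

(** Dividing by [k] makes the base equal to 1 at [x0], where the principal power is the required
    branch, and leaves the logarithmic derivative unchanged. *)
Lemma near_is_derive_pole3_pow (k x0 : K) : k != 0 -> pole3 x0 = k ->
  \forall x \near x0, is_derive (x : K) 1
    (fun z => cpow (pole3 z / k) (- (1 / 28)) : K)
    (cpow (pole3 x / k) (- (1 / 28)) * dlog3 x).
Proof.
move=> k0 x0k.
have g0 : pole3 x0 != 0 by rewrite x0k.
have gN := is_derive_near_neq0 (is_derive_pole3 x0) g0.
have H := near_is_derive_cpow (- (1 / 28)) (is_derive_scaled_pole3 k)
  (x0 := x0) (etrans (congr1 (fun z => z / k) x0k) (divff k0)).
apply: filterS2 gN H => x gx dx; apply: is_derive_eq dx _; congr (_ * _).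
by rewrite /dlog3; field; rewrite k0 gx.
Qed.

Lemma hyp2F1_solution_frac (a b c : nat) (a' b' c' : nat) :
  (0 < a)%N -> (0 < b)%N -> (0 < a')%N -> (0 < b')%N -> (0 < c')%N ->
  (a * c' <= c * a')%N -> (b <= b')%N ->
  hypergeometric_solution_near (a%:R / a'%:R : K) (b%:R / b'%:R) (c%:R / c'%:R) 0
    (hyp2F1 (a%:R / a'%:R) (b%:R / b'%:R) (c%:R / c'%:R)).
Proof.
move=> a0 b0 a'0 b'0 c'0 ac bb; apply: hyp2F1_solution.
  by rewrite divr_nat_gt0 // ler_natfrac.
by rewrite divr_nat_gt0 //= -[X in _ <= X]divr1 (@ler_natfrac _ b b' 1 1) // muln1 mul1n.
Qed.

Lemma identity_at0 : near_point (0 : R[i]) (fun x =>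
  hyp2F1 (5 / 42) (19 / 42) (5 / 7) x =
  cpow (1 - 19 / 9 * x - 343 / 243 * x ^+ 2 + 16807 / 6561 * x ^+ 3) (- (1 / 28))
  * hyp2F1 (1 / 84) (29 / 84) (6 / 7) (ratfun_eval phi3 x)).
Proof.
have k0 : 3 ^+ 8 != 0 :> K by rewrite expf_neq0 // pnatr_eq0.
have p0 : ratfun_eval phi3 (0 : K) = 0.
  by rewrite phi3E expr0n /= !mul0r oppr0 mul0r.
have S1 := @hyp2F1_solution_frac 5 19 5 42 42 7 isT isT isT isT isT isT isT.
have S2 := @hyp2F1_solution_frac 1 29 6 84 84 7 isT isT isT isT isT isT isT.
(* The source is pulled back at its own singular point 0 = phi3(0), which the coefficient identities
   allow. *)
rewrite -{1}p0 in S2.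
have g0 : pole3 (0 : K) != 0 by rewrite pole3_at0.
have S3 := phi3_pullback g0 (near_is_derive_pole3_pow k0 (pole3_at0 K)) S2.
have c0 : 0 < 5 / 7 :> K by exact: divr_nat_gt0.
have E0 : hyp2F1 (5 / 42) (19 / 42) (5 / 7) (0 : K) =
    cpow (pole3 (0 : K) / 3 ^+ 8) (- (1 / 28)) *
    hyp2F1 (1 / 84) (29 / 84) (6 / 7) (ratfun_eval phi3 (0 : K)).
  by rewrite p0 !hyp2F1_at0 pole3_at0 divff // cpow1 mulr1.
move: (solution_unique c0 E0 S1 S3); apply: filterS => x H.
exact: (etrans H (congr1 (fun w => cpow w _ * _) (esym (pole3_normalized0 x)))).
Qed.

Lemma identity_at1 : near_point (0 : R[i]) (fun x =>
  hyp2F1 (5 / 42) (19 / 42) (6 / 7) x =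
  cpow (1 - 141 / 2 * x + 5145 / 32 * x ^+ 2 - 16807 / 256 * x ^+ 3) (- (1 / 28))
  * hyp2F1 (1 / 84) (29 / 84) (6 / 7) (ratfun_eval phi3 (1 - x))).
Proof.
have k0 : 256 != 0 :> K by rewrite pnatr_eq0.
have p0 : ratfun_eval phi3 (1 : K) = 0.
  by rewrite phi3E subrr mulr0 mul0r oppr0 mul0r.
have S1 := @hyp2F1_solution_frac 5 19 6 42 42 7 isT isT isT isT isT isT isT.
have S2 := @hyp2F1_solution_frac 1 29 6 84 84 7 isT isT isT isT isT isT isT.
rewrite -{1}p0 in S2.
have g0 : pole3 (1 : K) != 0 by rewrite pole3_at1.
have S3 := phi3_pullback g0 (near_is_derive_pole3_pow k0 (pole3_at1 K)) S2.
rewrite -[X in hypergeometric_solution_near _ _ _ X](subr0 1) in S3.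
have := solution_reflect S3.
have -> : 5 / 42 + 19 / 42 + 1 - 5 / 7 = 6 / 7 :> K by field.
move=> S4.
have c0 : 0 < 6 / 7 :> K by exact: divr_nat_gt0.
have E0 : hyp2F1 (5 / 42) (19 / 42) (6 / 7) (0 : K) =
    cpow (pole3 (1 - 0 : K) / 256) (- (1 / 28)) *
    hyp2F1 (1 / 84) (29 / 84) (6 / 7) (ratfun_eval phi3 (1 - 0 : K)).
  by rewrite subr0 p0 !hyp2F1_at0 pole3_at1 divff // cpow1 mulr1.
move: (solution_unique c0 E0 S1 S4); apply: filterS => x H.
exact: (etrans H (congr1 (fun w => cpow w _ * _) (esym (pole3_normalized1 x)))).
Qed.

Lemma identity_atoo : near_point (0 : R[i]) (fun x =>
  hyp2F1 (5 / 42) (17 / 42) (2 / 3) x =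
  cpow (1 - x) (- (1 / 84)) * cpow (1 - 81 / 49 * x) (- (1 / 12))
  * hyp2F1 (1 / 84) (13 / 84) (2 / 3) (ratfun_eval phi3 x^-1)^-1).
Proof.
have p0 : phi3V (0 : K) = 0 by rewrite /phi3V mulr0 mul0r oppr0 mul0r.
have S1 := @hyp2F1_solution_frac 5 17 2 42 42 3 isT isT isT isT isT isT isT.
have S2 := @hyp2F1_solution_frac 1 13 2 84 84 3 isT isT isT isT isT isT isT.
rewrite -{1}p0 in S2.
have y0 : 1 - 0 != 0 :> K by rewrite subr0 oner_neq0.
have v0 : poleV (0 : K) != 0 by rewrite /poleV mulr0 subr0 pnatr_eq0.
have z0 : zeroV (0 : K) != 0.
  by rewrite /zeroV !expr0n /= !mulr0 !subr0 addr0 expf_neq0 // pnatr_eq0.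
have yN := is_derive_near_neq0 (is_derive_onem 0) y0.
have vN := is_derive_near_neq0 (is_derive_poleV 0) v0.
have zN := is_derive_near_neq0 (is_derive_zeroV 0) z0.
have d2 (x : K) : is_derive x 1 (fun z : K => 1 - 81 / 49 * z) (- (81 / 49)).
  have -> : (fun z : K => 1 - 81 / 49 * z) = (fun z => 1 + - (81 / 49) * z).
    by apply/funext => z; rewrite mulNr.
  apply: is_derive_eq (fun_is_deriveD (is_derive_cst (1 : K) x 1)
    (fun_is_deriveM (is_derive_cst (- (81 / 49) : K) x 1) (is_derive_id x 1))) _.
  by rewrite /cst; ring.
have f1 : 1 - 0 = 1 :> K by rewrite subr0.
have f2 : 1 - 81 / 49 * 0 = 1 :> K by rewrite mulr0 subr0.
have T1 := near_is_derive_cpow (- (1 / 84)) (@is_derive_onem K) f1.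
have T2 := near_is_derive_cpow (- (1 / 12)) d2 f2.
have dth : \forall x \near (0 : K), is_derive (x : K) 1
    (fun z => cpow (1 - z) (- (1 / 84)) * cpow (1 - 81 / 49 * z) (- (1 / 12)) : K)
    (cpow (1 - x) (- (1 / 84)) * cpow (1 - 81 / 49 * x) (- (1 / 12)) * dlogV x).
  near=> x.
  have e1 : is_derive (x : K) 1 (fun z => cpow (1 - z) (- (1 / 84)) : K)
    (cpow (1 - x) (- (1 / 84)) * (- (1 / 84) * (- 1 / (1 - x)))) by near: x.
  have e2 : is_derive (x : K) 1 (fun z => cpow (1 - 81 / 49 * z) (- (1 / 12)) : K)
    (cpow (1 - 81 / 49 * x) (- (1 / 12)) *
      (- (1 / 12) * (- (81 / 49) / (1 - 81 / 49 * x)))) by near: x.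
  have yx : 1 - x != 0 by near: x.
  have vx : poleV x != 0 by near: x.
  apply: is_derive_eq (fun_is_deriveM e1 e2) _.
  have -> : 1 - 81 / 49 * x = poleV x / 49 by rewrite /poleV; field.
  by rewrite /dlogV; field; rewrite vx yx.
have S3 := phi3V_pullback y0 v0 dth S2.
have c0 : 0 < 2 / 3 :> K by exact: divr_nat_gt0.
have E0 : hyp2F1 (5 / 42) (17 / 42) (2 / 3) (0 : K) =
    cpow (1 - 0 : K) (- (1 / 84)) * cpow (1 - 81 / 49 * 0 : K) (- (1 / 12)) *
    hyp2F1 (1 / 84) (13 / 84) (2 / 3) (phi3V (0 : K)).
  by rewrite p0 !hyp2F1_at0 f1 f2 !cpow1 !mulr1.
have S4 := solution_unique c0 E0 S1 S3.
rewrite /near_point; near=> x.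
have H : hyp2F1 (5 / 42) (17 / 42) (2 / 3) x = cpow (1 - x) (- (1 / 84)) *
  cpow (1 - 81 / 49 * x) (- (1 / 12)) * hyp2F1 (1 / 84) (13 / 84) (2 / 3) (phi3V x).
  by near: x.
(* The solution was built with the polynomial form [phi3V], differentiable at 0; it agrees with the
   stated expression at every nearby point, x = 0 included. *)
suff E : phi3V x = (ratfun_eval phi3 x^-1)^-1.
  exact: (etrans H (congr1 (fun w => _ * hyp2F1 _ _ _ w) E)).
have [->|x0] := eqVneq x 0; first exact: esym (phi3V_E0 K).
have yx : 1 - x != 0 by near: x.
have vx : poleV x != 0 by near: x.
have zx : zeroV x != 0 by near: x.
exact: esym (phi3V_E x0 yx vx zx).
Unshelve. all: by end_near. Qed.

Lemma phi3_defines_pullback : defines_pullback (phi3 : ratfun R[i])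
  (1 / 84) (29 / 84) (6 / 7) (5 / 42) (19 / 42) (5 / 7).
Proof.
pose G : {poly K} := 7 ^+ 5 *: 'X^3 - (3 ^+ 3 * 7 ^+ 3) *: 'X^2
  - (19 * 3 ^+ 6) *: 'X + (3 ^+ 8)%:P.
have GE x : G.[x] = pole3 x.
  by rewrite /G !(hornerM, horner_exp, hornerD, hornerN, hornerZ, hornerXn, hornerX, hornerC).
exists 1%N, (fun _ => (G, 1)), (fun _ => - (1 / 28)); split.
  move=> _; split; last exact: oner_neq0.
  apply/eqP => /= G0; have := pole3_at0 K; rewrite -GE G0 horner0 => /esym/eqP.
  by rewrite expf_eq0 /= pnatr_eq0.
move=> x0 theta y; rewrite phi3_denE mulf_eq0 negb_or expf_eq0 /= => /andP[_ g0].
move=> _ _ _ [L [dL eL thL]] Hy; apply: phi3_pullback => //.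
have gN := is_derive_near_neq0 (is_derive_pole3 x0) g0.
have eL' : \forall x \near (x0 : K), cexp (L ord0 x) = pole3 x.
  by move: (eL ord0); rewrite /near_point; apply: filterS => x ->; rewrite /ratfun_eval /= GE hornerC divr1.
have thL' : \forall x \near (x0 : K), cexp (- (1 / 28) * L ord0 x) = theta x.
  by move: thL; rewrite /near_point; apply: filterS => x ->; rewrite big_ord_recl big_ord0 addr0.
have := dL ord0; rewrite /holomorphic_near => dL0.
(* Differentiating these equalities at a point near [x0] requires them on a neighbourhood of that
   point. *)
have eL2 := near_join eL'; have thL2 := near_join thL'.
near=> x.
have gx : pole3 x != 0 by near: x.
have dLx : derivable (L ord0 : K -> K) (x : K) 1 by near: x.
have eLx : \forall z \near (x : K), cexp (L ord0 z) = pole3 z by near: x.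
have thx : \forall z \near (x : K), cexp (- (1 / 28) * L ord0 z) = theta z by near: x.
have D1 := is_derive_log_branch dLx eLx (is_derive_pole3 x).
have D2 := fun_is_deriveM (is_derive_cst (- (1 / 28) : K) x 1) D1.
have D3 := is_derive1_comp_field D2 (is_derive_cexp _).
have D4 := @near_eq_is_derive K K K _ (theta : K -> K) (x : K) 1 _ thx D3.
apply: is_derive_eq D4 _.
have <- : cexp (- (1 / 28) * L ord0 x) = theta x by exact: nbhs_singleton thx.
by rewrite /dlog3 /cst /=; field.
Unshelve. all: by end_near. Qed.

End Assembly.

(* In the last identity, phi3 (1 / x) has a pole at x = 0, and the convention
   0^-1 = 0 gives the right value 0 to 1 / phi3 (1 / x) there. *)
Theorem mainTheorem4 (R : realType) :
  [/\ P1_covering (phi3 : ratfun R[i]) 10,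
      exists a b c a' b' c' : R[i],
        [/\ exponent_differences a b c [:: 1 / 2; 1 / 3; 1 / 7],
            exponent_differences a' b' c' [:: 1 / 3; 1 / 7; 2 / 7] &
            defines_pullback phi3 a b c a' b' c'],
      near_point (0 : R[i]) (fun x =>
        hyp2F1 (5 / 42) (19 / 42) (5 / 7) x =
        cpow (1 - 19 / 9 * x - 343 / 243 * x ^+ 2 + 16807 / 6561 * x ^+ 3)
             (- (1 / 28))
        * hyp2F1 (1 / 84) (29 / 84) (6 / 7) (ratfun_eval phi3 x)),
      near_point (0 : R[i]) (fun x =>
        hyp2F1 (5 / 42) (19 / 42) (6 / 7) x =
        cpow (1 - 141 / 2 * x + 5145 / 32 * x ^+ 2 - 16807 / 256 * x ^+ 3)
             (- (1 / 28))
        * hyp2F1 (1 / 84) (29 / 84) (6 / 7) (ratfun_eval phi3 (1 - x))) &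
      near_point (0 : R[i]) (fun x =>
        hyp2F1 (5 / 42) (17 / 42) (2 / 3) x =
        cpow (1 - x) (- (1 / 84)) * cpow (1 - 81 / 49 * x) (- (1 / 12))
        * hyp2F1 (1 / 84) (13 / 84) (2 / 3) (ratfun_eval phi3 x^-1)^-1)].

Proof.
split.
- exact: phi3_covering.
- exists (1 / 84), (29 / 84), (6 / 7), (5 / 42), (19 / 42), (5 / 7); split.
  (* The differences are given at 0, 1, infinity in this order; a - b is negative here and for the
     target, hence the sign change at infinity. *)
  + exists (1 / 7), (1 / 2), (1 / 3); split.
    * by rewrite (perm_catC [:: _] [:: _; _]).
    * by left; field.
    * by left; field.
    * by right; field.
  + exists (2 / 7), (1 / 7), (1 / 3); split.
    * by rewrite -perm_rev.
    * by left; field.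
    * by left; field.
    * by right; field.
  + exact: phi3_defines_pullback.
- exact: identity_at0.
- exact: identity_at1.
- exact: identity_atoo.
Qed.
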